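(* Let $n=1$ or $n=3$, let $S^{2n}\subset\mathbb{R}^{2n+1}$ be the unit sphere with the standard metric $\langle-,-\rangle$ and Levi-Civita connection $\nabla$, and let $J$ be any almost complex structure on $S^{2n}$, with induced map $P^\perp:S^{2n}\to\mathcal{G}_{n+1,2n+1}$. The pullback along $P^\perp$ of the K\''ahler form $\omega$ on $\mathcal{G}_{n+1,2n+1}$ is given by $$(P^\perp)^*\omega(X,Y)=\sum_k\nu\big((\nabla_XJ)Z_k,(\nabla_YJ)Z_k\big)+\nu(X,Y)$$ for all tangent vectors $X,Y$ at a common point, where the sum is over any real tangent vectors $Z_k$ such that $\{Z_k+iJZ_k\}$ is an orthonormal basis of $T^{0,1}$, and $\nu(\alpha,\beta)=\langle M\alpha,\beta\rangle$, with $M$ the imaginary part of the orthogonal projection onto $T^{0,1}$.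
   Context: An almost complex structure on a manifold is a smooth section $J$ of $\operatorname{End}(TM)$ with $J^2=-\operatorname{Id}$. $(\nabla_X J)Y=\nabla_X(JY)-J\nabla_XY$. $T^{0,1}_x=\{v\in T_xS^{2n}\otimes\mathbb{C}: Jv=-iv\}$. The metric is extended to a complex inner product on $T_xS^{2n}\otimes\mathbb{C}$ (conjugate linear in the second variable); orthonormality refers to it. Let $Q:T_xS^{2n}\otimes\mathbb{C}\to T_xS^{2n}\otimes\mathbb{C}$ be the orthogonal projection onto $T^{0,1}_x$ and write $Q=R+iM$ with $R,M$ real linear operators on $T_xS^{2n}$; this defines $M$, and $\nu(\alpha,\beta)=\langle M\alpha,\beta\rangle$ is a $2$-form. $\mathcal{G}_{k,N}=\{P\in M_{N\times N}(\mathbb{C}):P^2=P,\ P^*=P,\ \operatorname{rank}P=k\}$. Tangent vectors at $P$ have, in the splitting $\mathbb{C}^N=\operatorname{Im}P\oplus\operatorname{Ker}P$, the form $A=\begin{bmatrix} 0 & B \\ B^* & 0 \end{bmatrix}$ with $B:\operatorname{Ker}P\to\operatorname{Im}P$. The K\''ahler form is $\omega=\frac1{2i}\operatorname{Tr}(P\,dP^2)$, i.e. $\omega(A,A')=\frac1{2i}\operatorname{Tr}(PAA'-PA'A)=\operatorname{Im}\operatorname{Tr}(BD^* )$ for $A=\begin{bmatrix} 0 & B \\ B^* & 0 \end{bmatrix}$ and $A'=\begin{bmatrix} 0 & D \\ D^* & 0 \end{bmatrix}$. The map $P^\perp$ sends $x$ to the orthogonal projection of $\mathbb{C}^{2n+1}$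 onto $T^{0,1}_x\oplus(N_x\otimes\mathbb{C})$, where $N_x$ is the Euclidean normal line to $S^{2n}$ at $x$. *)

(* Defs.v *)
(* MathComp-Analysis, over an arbitrary R : realType. *)
From HB Require Import structures.
From mathcomp Require Import all_boot all_order all_algebra.
From mathcomp Require Import spectral.
From mathcomp Require Import complex.
From mathcomp Require Import all_classical all_reals all_analysis.

Set Implicit Arguments.
Unset Strict Implicit.
Unset Printing Implicit Defensive.

Import Order.TTheory GRing.Theory Num.Theory.
Import numFieldNormedType.Exports.

Local Open Scope classical_set_scope.
Local Open Scope ring_scope.
Local Open Scope sesquilinear_scope.
Local Open Scope complex_scope.

Section Smoothness.
Context {R : realType}.

Fixpoint Ck_on (V W : normedModType R) (k : nat) (U : set V) (f : V -> W)
    : Prop :=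
  if k is k'.+1 then
    (forall x, U x -> differentiable f x) /\
    (forall v, Ck_on k' U (fun x => 'D_v f x))
  else forall x, U x -> {for x, continuous f}.

Definition smooth_on (V W : normedModType R) (U : set V) (f : V -> W) :=
  forall k, Ck_on k U f.

End Smoothness.

Section Sphere.
Context {R : realType} {d : nat}.
(* E is the Euclidean space containing the sphere S^d.  The library norm on
   'cV[R]_d.+1 is the sup norm, so the metric is given by [dot]. *)
Local Notation E := 'cV[R]_d.+1.

Definition dot (u v : E) : R := (u^T *m v) 0 0.

Definition sphere : set E := [set x | dot x x = 1].

Definition tangent (x : E) : set E := [set v | dot v x = 0].

Definition normal_line (x : E) : set E := [set v | exists a : R, v = a *: x].

(* A map on S^d is a function on E of which only the values on S^d matter; it
   is smooth when it extends locally to a smooth map on an open set of E. *)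
Definition smooth_sphere (W : normedModType R) (f : E -> W) :=
  forall x, sphere x -> exists U : set E, exists g : E -> W,
    [/\ open U, U x, smooth_on U g
      & forall y, U y -> sphere y -> g y = f y].

Definition retract (y : E) : E := (Num.sqrt (dot y y))^-1 *: y.

(* The differential at x, applied to v in T_x S^d, of a map on the sphere: the
   velocity at t = 0 of f along t |-> retract (x + t *: v), a curve of S^d
   through x with velocity v. *)
Definition dsphere (W : normedModType R) (f : E -> W) (x v : E) : W :=
  'D_v (f \o retract) x.

Definition vector_field (Y : E -> E) :=
  smooth_sphere Y /\ (forall x, sphere x -> tangent x (Y x)).

(* [nabla x v Y] is the covariant derivative at x of the vector field Y along
   v in T_x S^d. *)
Record levi_civita (nabla : E -> E -> (E -> E) -> E) : Prop := LeviCivita {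
  lc_tangent : forall x v Y, sphere x -> tangent x v -> vector_field Y ->
    tangent x (nabla x v Y);
  lc_smooth : forall X Y, vector_field X -> vector_field Y ->
    smooth_sphere (fun x => nabla x (X x) Y);
  lc_linear : forall x (a : R) u v Y,
    sphere x -> tangent x u -> tangent x v -> vector_field Y ->
    nabla x (a *: u + v) Y = a *: nabla x u Y + nabla x v Y;
  lc_add : forall x v Y Z,
    sphere x -> tangent x v -> vector_field Y -> vector_field Z ->
    nabla x v (fun y => Y y + Z y) = nabla x v Y + nabla x v Z;
  lc_leibniz : forall x v (f : E -> R^o) Y,
    sphere x -> tangent x v -> smooth_sphere f -> vector_field Y ->
    nabla x v (fun y => (f y : R) *: Y y)
    = (dsphere f x v : R) *: Y x + (f x : R) *: nabla x v Y;
  lc_metric : forall x v Y Z,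
    sphere x -> tangent x v -> vector_field Y -> vector_field Z ->
    dsphere (fun y => dot (Y y) (Z y) : R^o) x v
    = dot (nabla x v Y) (Z x) + dot (Y x) (nabla x v Z);
  (* nabla_X Y - nabla_Y X = [X, Y], as derivations of smooth functions *)
  lc_torsion_free : forall x X Y (f : E -> R^o),
    sphere x -> vector_field X -> vector_field Y -> smooth_sphere f ->
    dsphere f x (nabla x (X x) Y - nabla x (Y x) X)
    = dsphere (fun y => dsphere f y (Y y)) x (X x)
      - dsphere (fun y => dsphere f y (X y)) x (Y x) }.

(* An endomorphism of T_x S^d is encoded as the matrix of its extension by 0 on
   the normal line; this identifies End (T S^d) with a smooth subbundle of
   S^d * 'M_d.+1. *)
Record almost_complex (J : E -> 'M[R]_d.+1) : Prop := AlmostComplex {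
  ac_smooth : smooth_sphere J;
  ac_tangent : forall x v, sphere x -> tangent x v -> tangent x (J x *m v);
  ac_normal : forall x, sphere x -> J x *m x = 0;
  ac_square : forall x v, sphere x -> tangent x v ->
    J x *m (J x *m v) = - v }.

(* ((nabla_v J) Y)(x) = nabla_v (J Y) - J (nabla_v Y) *)
Definition nablaJ (nabla : E -> E -> (E -> E) -> E) (J : E -> 'M[R]_d.+1)
    (x v : E) (Y : E -> E) : E :=
  nabla x v (fun y => J y *m Y y) - J x *m nabla x v Y.

End Sphere.

Section ComplexLinearAlgebra.
Context {R : realType}.

Definition cplx_mx m n (A : 'M[R]_(m, n)) : 'M[R[i]]_(m, n) :=
  map_mx (real_complex R) A.
Definition Re_mx m n (A : 'M[R[i]]_(m, n)) : 'M[R]_(m, n) :=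
  map_mx (@complex.Re R) A.
Definition Im_mx m n (A : 'M[R[i]]_(m, n)) : 'M[R]_(m, n) :=
  map_mx (@complex.Im R) A.

Context {N : nat}.

(* Conjugate linear in the second variable. *)
Definition cdot (u v : 'cV[R[i]]_N) : R[i] := (v^t* *m u) 0 0.

(* V (x) C = V + i V *)
Definition complexify (V : set 'cV[R]_N) : set 'cV[R[i]]_N :=
  [set w | V (Re_mx w) /\ V (Im_mx w)].

Definition sum_space (V W : set 'cV[R[i]]_N) : set 'cV[R[i]]_N :=
  [set u | exists v w, [/\ V v, W w & u = v + w]].

Definition is_orth_proj (W : set 'cV[R[i]]_N) (P : 'M[R[i]]_N) : Prop :=
  [/\ P *m P = P, P^t* = P & forall v, W v <-> P *m v = v].

(* The orthogonal projection of C^N onto the linear subspace W. *)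
Definition orth_proj (W : set 'cV[R[i]]_N) : 'M[R[i]]_N :=
  xget 0 (is_orth_proj W).

Definition orthonormal_basis (W : set 'cV[R[i]]_N) m
    (e : 'I_m -> 'cV[R[i]]_N) : Prop :=
  [/\ forall k, W (e k),
      forall k l, cdot (e k) (e l) = (k == l)%:R
    & forall w, W w -> exists c : 'I_m -> R[i], w = \sum_k c k *: e k].

Definition grassmannian (k : nat) : set 'M[R[i]]_N :=
  [set P | [/\ P *m P = P, P^t* = P & \rank P = k]].

(* The Kaehler form of the Grassmannian at P on tangent vectors A, A'; it takes
   real values there. *)
Definition kaehler (P A A' : 'M[R[i]]_N) : R[i] :=
  (2 * 'i%C)^-1 * \tr (P *m A *m A' - P *m A' *m A).

End ComplexLinearAlgebra.

Section InducedMap.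
Context {R : realType} {d : nat}.
Local Notation E := 'cV[R]_d.+1.

Definition dsphereC (F : E -> 'M[R[i]]_d.+1) (x v : E) : 'M[R[i]]_d.+1 :=
  cplx_mx (dsphere (fun y => Re_mx (F y)) x v)
  + 'i%C *: cplx_mx (dsphere (fun y => Im_mx (F y)) x v).

Definition pullback_kaehler (F : E -> 'M[R[i]]_d.+1) (x X Y : E) : R[i] :=
  kaehler (F x) (dsphereC F x X) (dsphereC F x Y).

Variable J : E -> 'M[R]_d.+1.

Definition T01 (x : E) : set 'cV[R[i]]_d.+1 :=
  [set v | complexify (tangent x) v /\ cplx_mx (J x) *m v = - 'i%C *: v].

Definition Pperp (x : E) : 'M[R[i]]_d.+1 :=
  orth_proj (sum_space (T01 x) (complexify (normal_line x))).

(* T01 x lies in T_x S^d (x) C, so the orthogonal projection of C^d.+1 onto it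
   is that of T_x S^d (x) C extended by 0 on the normal line; Q = R + i M. *)
Definition Mpart (x : E) : 'M[R]_d.+1 := Im_mx (orth_proj (T01 x)).

Definition nu (x a b : E) : R := dot (Mpart x *m a) b.

End InducedMap.

(* The projections above exist and are unique, and Pperp takes its values in
   the Grassmannian. *)
Section WellDefined.
Context {R : realType}.

Lemma is_orth_proj_uniq N (W : set 'cV[R[i]]_N) P P' :
  is_orth_proj W P -> is_orth_proj W P' -> P = P'.
Proof.
move=> [idP hP WP] [idP' hP' WP'].
have im A B : (forall v, W v <-> A *m v = v) ->
    (forall v, W v <-> B *m v = v) -> B *m B = B -> A *m B = B.
  move=> WA WB idB; apply: trmx_inj; apply/row_matrixP => j.
  rewrite -!tr_col; congr (_^T); rewrite !colE -mulmxA.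
  by apply/WA/WB; rewrite mulmxA idB.
have e1 : P *m P' = P' by exact: im.
have e2 : P' *m P = P by exact: im.
by rewrite -[LHS]hP -[in LHS]e2 trmx_mul map_mxM hP hP' e1.
Qed.

Lemma trmxC_mul m n p (A : 'M[R[i]]_(m, n)) (B : 'M[R[i]]_(n, p)) :
  (A *m B)^t* = B^t* *m A^t*.
Proof. by rewrite trmx_mul map_mxM. Qed.

Lemma orth_projP N (W : set 'cV[R[i]]_N) (L : 'M[R[i]]_N) :
  L *m L = L -> (forall v, W v <-> L *m v = v) ->
  is_orth_proj W (orth_proj W).
Proof.
move=> idL WL; apply: (xgetPex 0).
have [p [idp le po fixp]] : exists p : 'M[R[i]]_N,
    [/\ p *m p = p, (p <= L^T)%MS, (1%:M - p) *m p^t* = 0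
      & forall v : 'rV_N, (v <= L^T)%MS -> v *m p = v].
  exists (proj_ortho L^T).
  have le : (proj_ortho L^T <= L^T)%MS by rewrite -[proj_ortho _]mul1mx proj_ortho_sub.
  split=> //; [exact: proj_ortho_proj| |by move=> v; exact: proj_ortho_id].
  have := proj_ortho_compl_sub L^T 1%:M; rewrite !mul1mx => h.
  apply/orthomx1P; rewrite orthomx_sym.
  by apply: (submx_trans le); rewrite orthomx_sym.
have hp : p^t* = p.
  have e : p^t* = p *m p^t*.
    by apply/eqP; rewrite -subr_eq0 -{1}[p^t*]mul1mx -mulmxBl po.
  have pp : p *m p^t* = p.
    have e2 : p = (p *m p^t*)^t* by rewrite -e trmxCK.
    by rewrite [RHS]e2 trmxC_mul trmxCK.
  by rewrite e pp.
exists p^T; split.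
- by rewrite -trmx_mul idp.
- by rewrite -[in RHS]hp trmxK map_trmx trmxK.
- move=> v; rewrite WL; split=> h; apply: trmx_inj.
    rewrite trmx_mul trmxK fixp //.
    by rewrite -h trmx_mul submxMl.
  rewrite trmx_mul.
  have /submxP[D ->] : (v^T <= L^T)%MS.
    by rewrite -h trmx_mul trmxK mulmx_sub.
  by rewrite -mulmxA -trmx_mul idL.
Qed.

End WellDefined.

Section Grassmannian.
Context {R : realType}.

Lemma cplx_mxM m n p (A : 'M[R]_(m, n)) (B : 'M[R]_(n, p)) :
  cplx_mx (A *m B) = cplx_mx A *m cplx_mx B.
Proof. exact: map_mxM. Qed.

Lemma cplx_mxReIm m n (A : 'M[R[i]]_(m, n)) :
  A = cplx_mx (Re_mx A) + 'i%C *: cplx_mx (Im_mx A).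
Proof.
by apply/matrixP => i j; rewrite !mxE; case: (A i j) => a b; simpc.
Qed.

Lemma cplx_mx_inj m n (A B A' B' : 'M[R]_(m, n)) :
  cplx_mx A + 'i%C *: cplx_mx B = cplx_mx A' + 'i%C *: cplx_mx B' ->
  A = A' /\ B = B'.
Proof.
move=> /matrixP h; split; apply/matrixP => i j; move: (h i j);
  by rewrite !mxE; simpc; case.
Qed.

Context {d : nat}.
Local Notation E := 'cV[R]_d.+1.

Lemma tangentP (x v : E) : tangent x v <-> x^T *m v = 0.
Proof.
rewrite /tangent /= /dot -[v^T *m x]trmxK trmx_mul trmxK mxE.
split=> [h|->]; last by rewrite mxE.
by apply/matrixP => i j; rewrite !ord1 h mxE.
Qed.

Lemma complexify_tangentP (x : E) (v : 'cV[R[i]]_d.+1) :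
  complexify (tangent x) v <-> cplx_mx x^T *m v = 0.
Proof.
rewrite /complexify /= !tangentP [in X in _ <-> X](cplx_mxReIm v).
rewrite mulmxDr -scalemxAr -!cplx_mxM; split=> [[-> ->]|h].
  by rewrite /cplx_mx raddf0 scaler0 addr0.
apply: cplx_mx_inj; rewrite h.
by rewrite /cplx_mx raddf0 scaler0 addr0.
Qed.

Lemma complexify_normalP (x : E) (v : 'cV[R[i]]_d.+1) : sphere x ->
  complexify (normal_line x) v <-> cplx_mx (x *m x^T) *m v = v.
Proof.
move=> hx; have xx : x^T *m x = 1%:M.
  by apply/matrixP => i j; rewrite !ord1 -/(dot x x) hx mxE.
have nP w : normal_line x w <-> x *m x^T *m w = w.
  split=> [[a ->]|h].
    by rewrite -scalemxAr -mulmxA xx mulmx1.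
  exists ((x^T *m w) 0 0); rewrite -[LHS]h -mulmxA.
  by rewrite {1}[x^T *m w]mx11_scalar mul_mx_scalar.
rewrite /complexify /= !nP [in X in _ <-> X](cplx_mxReIm v).
rewrite mulmxDr -scalemxAr -!cplx_mxM; split=> [[-> ->]//|h].
exact: cplx_mx_inj.
Qed.

Variable J : E -> 'M[R]_d.+1.
Hypothesis hJ : almost_complex J.

(* An oblique projection onto T01 x. *)
Definition K01 (x : E) : 'M[R[i]]_d.+1 :=
  2^-1 *: (cplx_mx (1%:M - x *m x^T) + 'i%C *: cplx_mx (J x)).

Variable x : E.
Hypothesis hx : sphere x.

Let xx : x^T *m x = 1%:M.
Proof. by apply/matrixP => i j; rewrite !ord1 -/(dot x x) hx mxE. Qed.

Let xp : x^T *m (1%:M - x *m x^T) = 0.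
Proof. by rewrite mulmxBr mulmx1 mulmxA xx mul1mx subrr. Qed.

Let px : (1%:M - x *m x^T) *m x = 0.
Proof. by rewrite mulmxBl mul1mx -mulmxA xx mulmx1 subrr. Qed.

Let pp : (1%:M - x *m x^T) *m (1%:M - x *m x^T) = 1%:M - x *m x^T.
Proof. by rewrite mulmxBl mul1mx -mulmxA xp mulmx0 subr0. Qed.

Let Jp : J x *m (1%:M - x *m x^T) = J x.
Proof. by rewrite mulmxBr mulmx1 mulmxA (ac_normal hJ hx) mul0mx subr0. Qed.

Let eqcol (A B : 'M[R]_d.+1) : (forall v : E, A *m v = B *m v) -> A = B.
Proof.
move=> h; apply: trmx_inj; apply/row_matrixP => j.
by rewrite -!tr_col !colE h.
Qed.

Let tpv (v : E) : tangent x ((1%:M - x *m x^T) *m v).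
Proof. by apply/tangentP; rewrite mulmxA xp mul0mx. Qed.

Let xJ : x^T *m J x = 0.
Proof.
apply: trmx_inj; apply/row_matrixP => j.
rewrite -!tr_col !colE -Jp -!mulmxA; congr (_^T).
rewrite mul0mx; exact/tangentP/(ac_tangent hJ hx)/tpv.
Qed.

Let pJ : (1%:M - x *m x^T) *m J x = J x.
Proof. by rewrite mulmxBl mul1mx -mulmxA xJ mulmx0 subr0. Qed.

Let JJ : J x *m J x = - (1%:M - x *m x^T).
Proof.
apply: eqcol => v; rewrite mulNmx -(ac_square hJ hx (tpv v)).
by rewrite (mulmxA (J x) (_ - _) v) Jp mulmxA.
Qed.

Lemma xK01 : cplx_mx x^T *m K01 x = 0.
Proof.
rewrite /K01 -scalemxAr mulmxDr -scalemxAr -!cplx_mxM xp xJ.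
by rewrite /cplx_mx raddf0 scaler0 addr0 scaler0.
Qed.

Lemma K01x : K01 x *m cplx_mx x = 0.
Proof.
rewrite /K01 -scalemxAl mulmxDl -scalemxAl -!cplx_mxM px (ac_normal hJ hx).
by rewrite /cplx_mx raddf0 scaler0 addr0 scaler0.
Qed.

Let ii : 'i%C * 'i%C = -1 :> R[i].
Proof. by simpc. Qed.

Let half_double p (A : 'M[R[i]]_(d.+1, p)) : 2^-1 *: (A + A) = A.
Proof.
by rewrite -[in LHS](scale1r A) -scalerDl scalerA mulVf ?scale1r ?pnatr_eq0.
Qed.

Lemma JK01 : cplx_mx (J x) *m K01 x = - 'i%C *: K01 x.
Proof.
rewrite /K01 -scalemxAr mulmxDr -scalemxAr -!cplx_mxM Jp JJ.
rewrite scalerA mulrC -scalerA; congr (_ *: _).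
rewrite scalerDr scalerA mulNr ii opprK scale1r addrC; congr (_ + _).
by rewrite /cplx_mx raddfN /= scalerN scaleNr.
Qed.

Lemma K01_idem : K01 x *m K01 x = K01 x.
Proof.
rewrite {1}/K01 -scalemxAl mulmxDl -scalemxAl JK01.
rewrite scalerA mulrN ii opprK scale1r.
have -> : cplx_mx (1%:M - x *m x^T) *m K01 x = K01 x.
  rewrite /K01 -scalemxAr mulmxDr -scalemxAr -!cplx_mxM pp pJ //.
exact: half_double.
Qed.

Lemma T01P v : T01 J x v <-> K01 x *m v = v.
Proof.
split=> [[/complexify_tangentP tv Jv]|<-].
  rewrite /K01 -scalemxAl mulmxDl -scalemxAl Jv scalerA mulrN ii opprK scale1r.
  have -> : cplx_mx (1%:M - x *m x^T) *m v = v.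
    rewrite /cplx_mx map_mxB mulmxBl map_mx1 mul1mx -/(cplx_mx _) cplx_mxM.
    by rewrite -mulmxA tv mulmx0 subr0.
  exact: half_double.
split; first by apply/complexify_tangentP; rewrite mulmxA xK01 mul0mx.
by rewrite mulmxA JK01 scalemxAl.
Qed.

Let L := K01 x + cplx_mx (x *m x^T).

Let KN : K01 x *m cplx_mx (x *m x^T) = 0.
Proof. by rewrite cplx_mxM mulmxA K01x mul0mx. Qed.

Let NK : cplx_mx (x *m x^T) *m K01 x = 0.
Proof. by rewrite cplx_mxM -mulmxA xK01 mulmx0. Qed.

Let NN : cplx_mx (x *m x^T) *m cplx_mx (x *m x^T) = cplx_mx (x *m x^T).
Proof. by rewrite -cplx_mxM mulmxA -[x *m _ *m x]mulmxA xx mulmx1. Qed.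

Let idL : L *m L = L.
Proof. by rewrite mulmxDl !mulmxDr K01_idem KN NK NN addr0 add0r. Qed.

Let LP v : sum_space (T01 J x) (complexify (normal_line x)) v <-> L *m v = v.
Proof.
split=> [[a [b [/T01P Ka /(complexify_normalP _ hx) Nb ->]]]|h].
  rewrite mulmxDr [L *m a]mulmxDl [L *m b]mulmxDl Ka Nb.
  by rewrite -[in _ *m a]Ka -[in K01 x *m b]Nb 2!mulmxA NK KN !mul0mx addr0 add0r.
exists (K01 x *m v), (cplx_mx (x *m x^T) *m v); split.
- by apply/T01P; rewrite mulmxA K01_idem.
- by apply/(complexify_normalP _ hx); rewrite mulmxA NN.
- by rewrite -mulmxDl.
Qed.

Lemma T01_orth_projP : is_orth_proj (T01 J x) (orth_proj (T01 J x)).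
Proof. exact: (orth_projP K01_idem T01P). Qed.

Lemma Pperp_orth_projP :
  is_orth_proj (sum_space (T01 J x) (complexify (normal_line x))) (Pperp J x).
Proof. exact: (orth_projP idL LP). Qed.

Let rank_idem (A B : 'M[R[i]]_d.+1) : A *m A = A -> A *m B = 0 -> B *m A = 0 ->
  B *m B = B -> \rank (A + B)%R = (\rank A + \rank B)%N.
Proof.
move=> AA AB BA BB.
rewrite -mxrank_disjoint_sum; last first.
  apply/eqP/rowV0Pn => -[w]; rewrite sub_capmx => /andP[/submxP[a wa]].
  move=> /submxP[b wb]; rewrite wb => /eqP; apply.
  by rewrite -BB mulmxA -wb wa -mulmxA AB mulmx0.
apply/eqP; rewrite eqn_leq (mxrankS (addmx_sub_adds _ _)) //=.
apply: mxrankS; rewrite addsmx_sub; apply/andP; split.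
  by apply/submxP; exists A; rewrite mulmxDr AA AB addr0.
by apply/submxP; exists B; rewrite mulmxDr BA BB add0r.
Qed.

Lemma rank_Pperp : (\rank (Pperp J x)).*2 = d.+2.
Proof.
have [idP _ WP] := Pperp_orth_projP.
have LQ (v : 'cV_d.+1) : L *m v = v <-> Pperp J x *m v = v.
  by split=> [/LP/WP|/WP/LP].
have absorb (A B : 'M[R[i]]_d.+1) :
    (forall v : 'cV_d.+1, B *m v = v -> A *m v = v) -> B *m B = B ->
    (\rank B <= \rank A)%N.
  move=> h BB; suff <- : A *m B = B by rewrite mxrankM_maxl.
  apply: trmx_inj; apply/row_matrixP => j.
  rewrite -!tr_col !colE -mulmxA; congr (_^T).
  by apply: h; rewrite mulmxA BB.
have -> : \rank (Pperp J x) = \rank L.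
  by apply/eqP; rewrite eqn_leq !absorb // => v /LQ.
pose Kb := map_mx Num.conj (K01 x).
have KbE : Kb = 1%:M - L.
  have cR m n (A : 'M[R]_(m, n)) : map_mx Num.conj (cplx_mx A) = cplx_mx A.
    by apply/matrixP => i j; rewrite !mxE /=; apply/eqP; rewrite eq_complex /= oppr0 !eqxx.
  have P0 : cplx_mx (1%:M - x *m x^T) = 1%:M - cplx_mx (x *m x^T).
    by rewrite /cplx_mx map_mxB map_mx1.
  have -> : 1%:M - L = cplx_mx (1%:M - x *m x^T) - K01 x.
    by rewrite P0 /L opprD [- K01 x - _]addrC addrA.
  apply/eqP; rewrite eq_sym subr_eq; apply/eqP.
  rewrite /Kb /K01 map_mxZ map_mxD map_mxZ /= !cR.
  have -> : Num.conj (2^-1 : R[i]) = 2^-1 by rewrite fmorphV rmorph_nat.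
  have -> : Num.conj ('i%C : R[i]) = - 'i%C.
    by apply/eqP; rewrite eq_complex /= oppr0 !eqxx.
  rewrite -scalerDr scaleNr addrACA addNr addr0.
  by rewrite half_double.
have rK : \rank Kb = \rank (K01 x) by rewrite mxrank_map.
have rN : \rank (cplx_mx (x *m x^T)) = 1%N.
  apply/eqP; rewrite eqn_leq lt0n mxrank_eq0; apply/andP; split.
    rewrite cplx_mxM (leq_trans (mxrankM_maxl _ _)) //; exact: rank_leq_col.
  apply/eqP => N0; have : cplx_mx (x^T *m (x *m x^T) *m x) = 1%:M.
    by rewrite mulmxA xx mul1mx xx /cplx_mx map_mx1.
  rewrite !cplx_mxM -cplx_mxM N0 mulmx0 mul0mx => /matrixP/(_ 0 0).
  by rewrite !mxE eqxx => /eqP; rewrite eq_sym oner_eq0.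
have rL : \rank L = (\rank (K01 x)).+1.
  by rewrite /L rank_idem ?K01_idem // rN addn1.
have e : \rank (L + (1%:M - L))%R = (\rank L + \rank (1%:M - L)%R)%N.
  apply: rank_idem => //.
  - by rewrite mulmxBr mulmx1 idL subrr.
  - by rewrite mulmxBl mul1mx idL subrr.
  - by rewrite mulmxBr mulmx1 [_ *m L]mulmxBl mul1mx idL subrr subr0.
move: e; rewrite addrC subrK mxrank1 -KbE rK rL.
by rewrite addSn addnn doubleS => e; congr _.+1.
Qed.

End Grassmannian.

Lemma Pperp_grassmannian (R : realType) n (J : 'cV[R]_(2 * n).+1 -> 'M[R]_((2 * n).+1))
    (x : 'cV[R]_(2 * n).+1) :
  almost_complex J -> sphere x -> grassmannian n.+1 (Pperp J x).
Proof.
move=> hJ hx; have [idP hP _] := Pperp_orth_projP hJ hx.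
split=> //; apply: double_inj; rewrite (rank_Pperp hJ hx).
by rewrite mul2n doubleS.
Qed.

(* Main.v *)
Require Import Defs.
From HB Require Import structures.
From mathcomp Require Import all_boot all_order all_algebra.
From mathcomp Require Import perm complex ring lra.
From mathcomp Require Import all_classical all_reals all_analysis.

Set Implicit Arguments.
Unset Strict Implicit.
Unset Printing Implicit Defensive.

Import Order.TTheory GRing.Theory Num.Theory.
Import numFieldNormedType.Exports.

Local Open Scope classical_set_scope.
Local Open Scope ring_scope.
Local Open Scope complex_scope.
Local Open Scope sesquilinear_scope.

(** The value of the Kaehler form at a projection [P] on hermitian matrices [A]
and [B] is the imaginary part of [\tr (P *m A *m B)], since exchanging [A] and
[B] conjugates this trace.  Over an orthonormal basis [e] of the image of [P]
the trace is the sum of the hermitian products of [A *m e k] and [B *m e k], so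
the theorem comes from knowing the differential [dP] of [Pperp J] on such a
basis.

If [s] is a section of the image, the derivative of [P *m s = s] reads
[dP *m s = (1 - P) *m ds] ([dPperp_section]).  The image is spanned by [x] and
by the vectors [Z k + i J Z k].  The section [y |-> y] has derivative [X] in
the direction [X], which gives [dP *m x = (1 - P) *m X].  For the section
[Z + i J Z], where [Z] is a vector field, the derivative may be replaced by its
tangential part, as [1 - P] kills the normal direction; this part is
[nabla Z + i nabla (J Z) = (nabla Z + i J (nabla Z)) + i (nabla J) Z], and the
first summand lies in [T01], which [1 - P] kills too.  Hence
[dP *m (Z + i J Z) = i (1 - P) *m (nabla J) Z] ([dPperp_T01]).  Finally, for
real tangent vectors [u] and [w], the imaginary part of the hermitian product
of [(1 - P) *m u] and [(1 - P) *m w] is [nu u w] ([compl_form_nu]): the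
projection onto [T01] is hermitian, so that its imaginary part [M] is skew.

Two points need an argument of their own.  The connection is only known by its
axioms; that it is the tangential part of the derivative
([levi_civita_sphere]) is the uniqueness of the Levi-Civita connection.  And
[dsphere] is a derivative only where the map is differentiable, so [Pperp J]
has to be shown differentiable.  With [S] the skew part of [J x], the matrix
[G = x x^T - S^2] is invertible, and the projection onto [T01] is
[((S i - J x S) / 2) G^-1] ([Q01E]), a rational function of [x] and [J x]
without pole ([derivable_Pperp]). *)

(** * Derivatives of matrix-valued maps *)

Section MatrixCalculus.
Context {R : realType} {V : normedModType R}.
Implicit Types t v : V.

(** Written as a sum of functions, so that results on sums of maps apply to a
matrix-valued map known through its entries. *)
Lemma mx_coord_sum m n (F : V -> 'M[R]_(m, n)) :
  F = \sum_i \sum_j (fun y => F y i j *: delta_mx i j).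
Proof.
apply/funext => y; rewrite [LHS]matrix_sum_delta fct_sumE.
by apply: eq_bigr => i _; rewrite fct_sumE.
Qed.

Lemma mulmx_coord_sum m n p (f : V -> 'M[R]_(m, n)) (g : V -> 'M[R]_(n, p))
    i k :
  (fun y => (f y *m g y) i k) =
  \sum_j ((fun y => f y i j : R) * (fun y => g y j k : R)).
Proof. by apply/funext => y; rewrite mxE fct_sumE. Qed.

Lemma derivable_coord m n (F : V -> 'M[R]_(m, n)) t v i j :
  derivable F t v -> derivable (fun y => F y i j) t v.
Proof. by move/derivable_mxP. Qed.

Lemma derive_coord m n (F : V -> 'M[R]_(m, n)) t v i j :
  derivable F t v -> ('D_v F t) i j = 'D_v (fun y => F y i j) t.
Proof. by move=> dF; rewrite derive_mx // mxE. Qed.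

Lemma derivable_mulmx m n p (f : V -> 'M[R]_(m, n)) (g : V -> 'M[R]_(n, p))
    t v :
  derivable f t v -> derivable g t v -> derivable (fun y => f y *m g y) t v.
Proof.
move=> df dg; apply/derivable_mxP => i k; rewrite mulmx_coord_sum.
by apply: derivable_sum => j; apply: derivableM; exact: derivable_coord.
Qed.

Lemma derive_mulmx m n p (f : V -> 'M[R]_(m, n)) (g : V -> 'M[R]_(n, p)) t v :
  derivable f t v -> derivable g t v ->
  'D_v (fun y => f y *m g y) t = 'D_v f t *m g t + f t *m 'D_v g t.
Proof.
move=> df dg; apply/matrixP => i k.
have dM j : derivable ((fun y => f y i j : R) * (fun y => g y j k : R)) t v.
  by apply: derivableM; exact: derivable_coord.
rewrite derive_coord; last exact: derivable_mulmx.
rewrite mulmx_coord_sum derive_sum // !mxE -big_split; apply: eq_bigr => j _.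
rewrite deriveM; try exact: derivable_coord.
rewrite (derive_coord _ _ df) (derive_coord _ _ dg) addrC; congr (_ + _).
exact: mulrC.
Qed.

Lemma derivable_trmx m n (F : V -> 'M[R]_(m, n)) t v :
  derivable F t v -> derivable (fun y => (F y)^T) t v.
Proof.
move=> dF; apply/derivable_mxP => i j.
have -> : (fun y => (F y)^T i j) = (fun y => F y j i).
  by apply/funext => y; rewrite mxE.
exact: derivable_coord.
Qed.

Lemma derive_trmx m n (F : V -> 'M[R]_(m, n)) t v :
  derivable F t v -> 'D_v (fun y => (F y)^T) t = ('D_v F t)^T.
Proof.
move=> dF; apply/matrixP => i j.
rewrite derive_coord; last exact: derivable_trmx.
rewrite mxE derive_coord //; congr ('D_v _ t).
by apply/funext => y; rewrite mxE.
Qed.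

Lemma derivable_prod (I : Type) (r : seq I) (f : I -> V -> R) t v :
  (forall i, derivable (f i) t v) -> derivable (\prod_(i <- r) f i) t v.
Proof.
move=> df; elim: r => [|i r IHr].
  by rewrite big_nil; exact: derivable_cst.
by rewrite big_cons; exact: derivableM (df i) IHr.
Qed.

Lemma derivable_bigsum (W : normedModType R) (I : Type) (r : seq I)
    (f : I -> V -> W) t v :
  (forall i, derivable (f i) t v) -> derivable (\sum_(i <- r) f i) t v.
Proof.
move=> df; elim: r => [|i r IHr].
  by rewrite big_nil; exact: derivable_cst.
by rewrite big_cons; exact: derivableD (df i) IHr.
Qed.

Lemma derivable_det n (F : V -> 'M[R]_n) t v :
  derivable F t v -> derivable (fun y => \det (F y)) t v.
Proof.
move=> dF.
have -> : (fun y => \det (F y)) =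
    \sum_(s : 'S_n) ((-1) ^+ s *: \prod_i (fun y => F y i (s i))).
  apply/funext => y; rewrite /determinant fct_sumE.
  by apply: eq_bigr => s _; rewrite /= fctE fct_prodE.
apply: derivable_bigsum => s; apply: derivableZ; apply: derivable_prod => i.
exact: derivable_coord.
Qed.

Lemma derivable_adjmx n (F : V -> 'M[R]_n) t v :
  derivable F t v -> derivable (fun y => \adj (F y)) t v.
Proof.
move=> dF; apply/derivable_mxP => i j.
have -> : (fun y => (\adj (F y)) i j) =
    (-1) ^+ (j + i) *: (fun y => \det (row' j (col' i (F y)))).
  by apply/funext => y; rewrite mxE.
apply/derivableZ/derivable_det/derivable_mxP => k l.
have -> : (fun y => row' j (col' i (F y)) k l) =
    (fun y => F y (lift j k) (lift i l)).
  by apply/funext => y; rewrite !mxE.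
exact: derivable_coord.
Qed.

Lemma derivable_scale m n (k : V -> R) (F : V -> 'M[R]_(m, n)) t v :
  derivable k t v -> derivable F t v -> derivable (fun y => k y *: F y) t v.
Proof.
move=> dk dF; apply/derivable_mxP => i j.
have -> : (fun y => (k y *: F y) i j) = k * (fun y => F y i j).
  by apply/funext => y; rewrite mxE.
exact: derivableM dk (derivable_coord dF).
Qed.

(** Stated with the adjugate rather than [invmx], whose case distinction on
invertibility hides that it is a rational function. *)
Lemma derivable_invmx n (F : V -> 'M[R]_n) t v :
  derivable F t v -> F t \in unitmx ->
  derivable (fun y => (\det (F y))^-1 *: \adj (F y)) t v.
Proof.
move=> dF Ft; apply: (derivable_scale (k := fun y => (\det (F y))^-1));
  last exact: derivable_adjmx.
apply: (derivableV (f := fun y => \det (F y))); last exact: derivable_det.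
by move: Ft; rewrite unitmxE unitfE.
Qed.

Lemma differentiable_mx m n (F : V -> 'M[R]_(m, n)) t :
  (forall i j, differentiable (fun y => F y i j) t) -> differentiable F t.
Proof.
move=> dF; rewrite [F]mx_coord_sum; apply: differentiable_sum => i.
by apply: differentiable_sum => j; exact: differentiableZl.
Qed.

Lemma differentiable_entry m n (F : V -> 'M[R]_(m, n)) t i j :
  differentiable F t -> differentiable (fun y => F y i j) t.
Proof.
by move=> dF; exact: (differentiable_comp dF (differentiable_coord (F t) i j)).
Qed.

Lemma differentiable_mulmx m n p (f : V -> 'M[R]_(m, n)) (g : V -> 'M[R]_(n, p))
    t :
  differentiable f t -> differentiable g t ->
  differentiable (fun y => f y *m g y) t.
Proof.
move=> df dg; apply: differentiable_mx => i k; rewrite mulmx_coord_sum.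
apply: differentiable_sum => j.
by apply: differentiableM; exact: differentiable_entry.
Qed.

Lemma continuous_mulmx m n p (f : V -> 'M[R]_(m, n)) (g : V -> 'M[R]_(n, p))
    t :
  {for t, continuous f} -> {for t, continuous g} ->
  {for t, continuous (fun y => f y *m g y)}.
Proof.
have entry q r (h : V -> 'M[R]_(q, r)) i j :
    {for t, continuous h} -> {for t, continuous (fun y => h y i j)}.
  by move=> hc; exact: (continuous_comp hc (@coord_continuous R q r i j (h t))).
have sum_cont (W : normedModType R) q (h : 'I_q -> V -> W) :
    (forall i, {for t, continuous (h i)}) ->
    {for t, continuous (\sum_i h i)}.
  move=> hc; elim/big_rec: _ => [|i y _ yc]; first exact: cst_continuous.
  exact: continuousD.
move=> fc gc; rewrite [X in {for t, continuous X}]mx_coord_sum.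
apply: (sum_cont) => i; apply: (sum_cont) => k.
apply: continuousZr_tmp; rewrite mulmx_coord_sum.
by apply: (sum_cont R^o) => j; apply: continuousM; exact: entry.
Qed.

End MatrixCalculus.

(** * Closure properties of [Ck_on] *)

Lemma near_eq_differentiable (R : numFieldType) (V W : normedModType R)
    (f g : V -> W) (t : V) :
  (\near t, f t = g t) -> differentiable f t -> differentiable g t.
Proof.
move=> fg df; have -> : g = f + (g - f).
  by apply/funext => y; rewrite !fctE addrC subrK.
apply: differentiableD => //.
(* [g - f] vanishes near [t], so its differential there is zero. *)
have fg0 : \forall y \near 0, f (y + t) = g (y + t).
  rewrite (near_shift t); apply: filterS fg => y fgy /=.
  by rewrite sub0r subrK.
have h0 : (g - f) \o shift t = cst ((g - f) t) + \0 +o_ 0 id.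
  apply/eqaddoP => _/posnumP[e]; near=> y.
  have gf0 z : f z = g z -> (g - f) z = 0 by move=> fgz; rewrite !fctE fgz subrr.
  rewrite !fctE /= [f t](nbhs_singleton fg) subrr.
  have -> : f (y + t) = g (y + t) by near: y.
  by rewrite subrr !add0r oppr0 normr0 mulr_ge0.
apply/diff_locallyP; rewrite (diff_unique (df := \0) _ h0);
  last exact: cst_continuous.
by split=> //; exact: cst_continuous.
Unshelve. all: by end_near. Qed.

Section CkClosure.
Context {R : realType} {V : normedModType R}.
Implicit Types U : set V.

Lemma Ck_onW (W : normedModType R) k U (f : V -> W) :
  Ck_on k.+1 U f -> Ck_on k U f.
Proof.
elim: k f => [|k IHk] f [df dDf]; first by move=> x /df/differentiable_continuous.
by split=> // v; exact/IHk/dDf.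
Qed.

Lemma sub_Ck_on (W : normedModType R) k U U' (f : V -> W) :
  U' `<=` U -> Ck_on k U f -> Ck_on k U' f.
Proof.
move=> sU; elim: k f => [|k IHk] f; first by move=> fc x /sU/fc.
by move=> [df dDf]; split=> [x /sU/df //|v]; exact/IHk/dDf.
Qed.

(** The product rule computes ['D_v] only where the factors are differentiable,
hence the need to modify a map outside of [U]. *)
Lemma eq_Ck_on (W : normedModType R) k U (f g : V -> W) :
  open U -> (forall x, U x -> f x = g x) -> Ck_on k U f -> Ck_on k U g.
Proof.
move=> oU; elim: k f g => [|k IHk] f g fg.
  move=> fc x Ux; have nfg : \near x, f x = g x.
    by apply: filterS (open_nbhs_nbhs (conj oU Ux)) => y /fg.
  change (g @ x --> g x); rewrite -(fg _ Ux).
  exact: cvg_trans (near_eq_cvg nfg) (fc _ Ux).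
have nfg x : U x -> \near x, f x = g x.
  by move=> Ux; apply: filterS (open_nbhs_nbhs (conj oU Ux)) => y /fg.
move=> [df dDf]; split=> [x Ux|v].
  exact: near_eq_differentiable (nfg _ Ux) (df _ Ux).
by apply: IHk (dDf v) => x Ux; apply: near_eq_derive; exact: nfg.
Qed.

Lemma Ck_on_cst (W : normedModType R) k U (a : W) : Ck_on k U (cst a).
Proof.
elim: k a => [|k IHk] a; first by move=> x _; exact: cst_continuous.
split=> [x _|v]; first exact: differentiable_cst.
have -> : (fun y => 'D_v (cst a) y) = cst 0.
  by apply/funext => y; rewrite derive_cst.
exact: IHk.
Qed.

Lemma Ck_on_id k U : Ck_on k U (@id V).
Proof.
case: k => [|k]; first by move=> x _; exact: cvg_id.
split=> [x _|v]; first exact: ex_diff.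
have -> : (fun y => 'D_v id y) = cst v by apply/funext => y; rewrite derive_id.
exact: Ck_on_cst.
Qed.

Lemma Ck_onD (W : normedModType R) k U (f g : V -> W) :
  open U -> Ck_on k U f -> Ck_on k U g -> Ck_on k U (fun y => f y + g y).
Proof.
move=> oU; elim: k f g => [|k IHk] f g.
  by move=> fc gc x Ux; exact: continuousD (fc _ Ux) (gc _ Ux).
move=> [df dDf] [dg dDg]; split=> [x Ux|v].
  exact: differentiableD (df _ Ux) (dg _ Ux).
apply: eq_Ck_on (IHk _ _ (dDf v) (dDg v)) => // x Ux.
by rewrite -deriveD //; apply: diff_derivable; [exact: df|exact: dg].
Qed.

Lemma Ck_on_mulmx m n p k U (f : V -> 'M[R]_(m, n)) (g : V -> 'M[R]_(n, p)) :
  open U -> Ck_on k U f -> Ck_on k U g -> Ck_on k U (fun y => f y *m g y).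
Proof.
move=> oU; elim: k f g => [|k IHk] f g.
  by move=> fc gc x Ux; exact: continuous_mulmx (fc _ Ux) (gc _ Ux).
move=> kf kg; have [[df dDf] [dg dDg]] := (kf, kg).
split=> [x Ux|v]; first exact: differentiable_mulmx (df _ Ux) (dg _ Ux).
have ck : Ck_on k U (fun y => 'D_v f y *m g y + f y *m 'D_v g y).
  apply: Ck_onD => //; first exact: IHk (dDf v) (Ck_onW kg).
  exact: IHk (Ck_onW kf) (dDg v).
apply: eq_Ck_on ck => // x Ux.
by rewrite derive_mulmx //; apply: diff_derivable; [exact: df|exact: dg].
Qed.

Lemma Ck_on_coord m n k U (F : V -> 'M[R]_(m, n)) i j :
  open U -> Ck_on k U F -> Ck_on k U (fun y => F y i j : R^o).
Proof.
move=> oU; elim: k F => [|k IHk] F.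
  move=> Fc x Ux.
  exact: (continuous_comp (Fc _ Ux) (@coord_continuous R _ _ i j _)).
move=> [dF dDF]; split=> [x Ux|v]; first exact: differentiable_entry (dF _ Ux).
apply: eq_Ck_on (IHk _ (dDF v)) => // x Ux.
by rewrite derive_coord //; apply/diff_derivable/dF.
Qed.

End CkClosure.

(** * Calculus on the sphere *)

Section SphereCalculus.
Context {R : realType} {d : nat}.
Local Notation E := 'cV[R]_d.+1.
Implicit Types x y u v w : E.

Lemma dot_mx u v : u^T *m v = (dot u v)%:M.
Proof. by rewrite [LHS]mx11_scalar. Qed.

Lemma dotC u v : dot u v = dot v u.
Proof.
by rewrite /dot -[v^T *m u]trmxK trmx_mul trmxK [in RHS]mxE.
Qed.

Lemma dotDl u v w : dot (u + v) w = dot u w + dot v w.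
Proof. by rewrite /dot raddfD /= mulmxDl mxE. Qed.

Lemma dotNl u w : dot (- u) w = - dot u w.
Proof. by rewrite /dot raddfN /= mulNmx mxE. Qed.

Lemma dotBl u v w : dot (u - v) w = dot u w - dot v w.
Proof. by rewrite dotDl dotNl. Qed.

Lemma dotZl (a : R) u w : dot (a *: u) w = a * dot u w.
Proof. by rewrite /dot linearZ /= -scalemxAl mxE. Qed.

Lemma dotZr (a : R) u w : dot u (a *: w) = a * dot u w.
Proof. by rewrite dotC dotZl dotC. Qed.

Lemma dot_ge0 u : 0 <= dot u u.
Proof.
by rewrite /dot mxE sumr_ge0 // => i _; rewrite mxE -expr2 sqr_ge0.
Qed.

Lemma dot_eq0 u : dot u u = 0 -> u = 0.
Proof.
rewrite /dot mxE => /eqP; rewrite psumr_eq0; last first.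
  by move=> i _; rewrite mxE -expr2 sqr_ge0.
move=> /allP u0; apply/matrixP => i j; rewrite ord1 [RHS]mxE.
by have := u0 i (mem_index_enum _); rewrite mxE -expr2 sqrf_eq0 => /eqP.
Qed.

Lemma retract_sphere y : 0 < dot y y -> sphere (retract y).
Proof.
move=> y0; rewrite /sphere /= /retract dotZl dotZr mulrA -expr2 exprVn.
by rewrite sqr_sqrtr ?dot_ge0 // mulVf // gt_eqF.
Qed.

Lemma retract_id x : sphere x -> retract x = x.
Proof. by rewrite /sphere /= /retract => ->; rewrite sqrtr1 invr1 scale1r. Qed.

Lemma differentiable_dot x : differentiable (fun y : E => dot y y) x.
Proof.
apply: (@differentiable_entry _ _ _ _ (fun y : E => y^T *m y)).
apply: (differentiable_mulmx (f := fun y : E => y^T)) => //.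
apply: differentiable_mx => i j.
have -> : (fun y : E => y^T i j) = (fun y => y j i).
  by apply/funext => y; rewrite mxE.
exact: differentiable_coord.
Qed.

Lemma near_dot_gt0 x : sphere x -> \near x, 0 < dot x x.
Proof.
move=> hx; have c := differentiable_continuous (differentiable_dot x).
apply: (cvgr_gt (dot x x) c); by rewrite hx.
Qed.

Lemma near_retract_sphere x : sphere x -> \near x, sphere (retract x).
Proof. by move/near_dot_gt0; apply: filterS => y; exact: retract_sphere. Qed.

(** The sphere is a level set of [dot y y], so that [retract] is the identity to
first order in tangent directions. *)
Lemma derive_dot_tangent x v : tangent x v -> 'D_v (fun y : E => dot y y) x = 0.
Proof.
move=> tv; have did : derivable (@id E) x v by exact: derivable_id.
have dtr := derivable_trmx did.
have := derive_mulmx dtr did; rewrite derive_trmx // derive_id.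
move=> /matrixP/(_ 0 0); rewrite derive_coord; last exact: derivable_mulmx.
move=> e; rewrite [LHS]e !mxE.
move: tv; rewrite /tangent /= /dot mxE => tv.
by rewrite tv add0r -[RHS]tv; apply: eq_bigr => i _; rewrite !mxE mulrC.
Qed.

Let norm y : R := Num.sqrt (dot y y).

Let differentiable_norm x : sphere x -> differentiable norm x.
Proof.
move=> hx; apply: (differentiable_comp (differentiable_dot x)).
apply/derivable1_diffP; rewrite hx.
by apply: ex_derive; exact: is_derive1_sqrt.
Qed.

Let norm1 x : sphere x -> norm x = 1.
Proof. by rewrite /norm => ->; rewrite sqrtr1. Qed.

Let derive_norm x v : sphere x -> tangent x v -> 'D_v norm x = 0.
Proof.
move=> hx tv; rewrite deriveE; last exact: differentiable_norm.
rewrite (@diff_comp _ _ _ _ (fun y : E => dot y y) Num.sqrt) /=.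
- rewrite -(deriveE v (differentiable_dot x)) derive_dot_tangent //.
  by rewrite linear0.
- exact: differentiable_dot.
- apply/derivable1_diffP; rewrite hx.
  by apply: ex_derive; exact: is_derive1_sqrt.
Qed.

Let retract_coord i j :
  (fun y : E => retract y i j) = (fun y => (norm y)^-1) * (fun y => y i j).
Proof. by apply/funext => y; rewrite mxE. Qed.

Lemma differentiable_retract x : sphere x -> differentiable (@retract R d) x.
Proof.
move=> hx; apply: differentiable_mx => i j; rewrite retract_coord.
apply: differentiableM; last exact: differentiable_coord.
apply: differentiableV; first exact: differentiable_norm.
by rewrite norm1 // oner_eq0.
Qed.

Lemma derive_retract x v : sphere x -> tangent x v ->
  'D_v (@retract R d) x = v.
Proof.
move=> hx tv; have dN : derivable norm x v.
  by apply: diff_derivable; exact: differentiable_norm.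
have N0 : norm x != 0 by rewrite norm1 // oner_eq0.
have did : derivable (@id E) x v by exact: derivable_id.
apply/matrixP => i j; rewrite derive_coord; last first.
  by apply: diff_derivable; exact: differentiable_retract.
rewrite retract_coord deriveM; last 2 first.
- exact: derivableV.
- exact: (derivable_coord did).
rewrite deriveV // derive_norm // !scaler0 addr0 norm1 // invr1 scale1r.
by rewrite -(derive_coord i j did) derive_id.
Qed.

(** The condition under which [dsphere f x v] is a derivative; composing with
[retract] makes it depend only on the values of [f] on the sphere. *)
Definition derivable_sphere (W : normedModType R) (f : E -> W) x v :=
  derivable (f \o @retract R d) x v.

Section CongruenceOnSphere.
Context {W : normedModType R}.
Variables (f g : E -> W).
Hypothesis fg : forall y, sphere y -> f y = g y.

Let near_eq_retract x : sphere x ->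
  \near x, (f \o @retract R d) x = (g \o @retract R d) x.
Proof. by move/near_retract_sphere; apply: filterS => y /fg. Qed.

Lemma eq_dsphere x v : sphere x -> dsphere f x v = dsphere g x v.
Proof. by move=> hx; apply: near_eq_derive; exact: near_eq_retract. Qed.

Lemma eq_derivable_sphere x v : sphere x ->
  derivable_sphere f x v -> derivable_sphere g x v.
Proof. by move=> hx; apply: near_eq_derivable; exact: near_eq_retract. Qed.

End CongruenceOnSphere.

Lemma smooth_derivable (W : normedModType R) (f : E -> W) x v :
  smooth_sphere f -> sphere x -> derivable_sphere f x v.
Proof.
move=> sf hx; have [U [g [oU Ux sg gf]]] := sf _ hx.
have dr := differentiable_retract hx.
have [dg _] := sg 1%N.
apply: (@near_eq_derivable _ _ _ (g \o @retract R d)).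
  have nU : \near x, U (retract x).
    have /= := differentiable_continuous dr.
    by apply; rewrite retract_id //; exact: open_nbhs_nbhs.
  have nS := near_retract_sphere hx.
  by near=> y; apply: gf; near: y.
apply/diff_derivable/differentiable_comp => //.
by rewrite retract_id //; exact: dg.
Unshelve. all: by end_near. Qed.

Lemma dsphereD (W : normedModType R) (f g : E -> W) x v :
  derivable_sphere f x v -> derivable_sphere g x v ->
  dsphere (fun y => f y + g y) x v = dsphere f x v + dsphere g x v.
Proof. exact: deriveD. Qed.

Lemma dsphereB (W : normedModType R) (f g : E -> W) x v :
  derivable_sphere f x v -> derivable_sphere g x v ->
  dsphere (fun y => f y - g y) x v = dsphere f x v - dsphere g x v.
Proof. exact: deriveB. Qed.

Lemma dsphereN (W : normedModType R) (f : E -> W) x v :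
  derivable_sphere f x v -> dsphere (fun y => - f y) x v = - dsphere f x v.
Proof. exact: deriveN. Qed.

Lemma derivable_sphere_mulmx m n p (f : E -> 'M[R]_(m, n))
    (g : E -> 'M[R]_(n, p)) x v :
  derivable_sphere f x v -> derivable_sphere g x v ->
  derivable_sphere (fun y => f y *m g y) x v.
Proof. exact: derivable_mulmx. Qed.

Lemma dsphere_mulmx m n p (f : E -> 'M[R]_(m, n))
    (g : E -> 'M[R]_(n, p)) x v : sphere x ->
  derivable_sphere f x v -> derivable_sphere g x v ->
  dsphere (fun y => f y *m g y) x v
  = dsphere f x v *m g x + f x *m dsphere g x v.
Proof.
move=> hx df dg; rewrite [LHS](derive_mulmx df dg).
by rewrite /= !retract_id.
Qed.

Lemma derivable_sphere_trmx m n (f : E -> 'M[R]_(m, n)) x v :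
  derivable_sphere f x v -> derivable_sphere (fun y => (f y)^T) x v.
Proof. exact: derivable_trmx. Qed.

Lemma dsphere_trmx m n (f : E -> 'M[R]_(m, n)) x v :
  derivable_sphere f x v -> dsphere (fun y => (f y)^T) x v = (dsphere f x v)^T.
Proof. exact: derive_trmx. Qed.

Lemma derivable_sphere_id x v : sphere x -> derivable_sphere (@id E) x v.
Proof. by move=> hx; exact/diff_derivable/differentiable_retract. Qed.

Lemma dsphere_id x v : sphere x -> tangent x v -> dsphere (@id E) x v = v.
Proof. exact: derive_retract. Qed.

Lemma dsphere_dotl a (f : E -> E) x v : sphere x ->
  derivable_sphere f x v ->
  dsphere (fun y => dot a (f y) : R^o) x v = dot a (dsphere f x v).
Proof.
move=> hx df; have da : derivable_sphere (cst a^T) x v by exact: derivable_cst.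
have dM := derivable_sphere_mulmx da df.
have := dsphere_mulmx hx da df.
have -> : dsphere (cst a^T) x v = 0 by exact: derive_cst.
rewrite mul0mx add0r => e.
transitivity (dsphere (fun y => cst a^T y *m f y) x v 0 0); last by rewrite e.
by rewrite [in RHS]/dsphere derive_coord.
Qed.

Lemma dsphere_dot (f g : E -> E) x v : sphere x ->
  derivable_sphere f x v -> derivable_sphere g x v ->
  dsphere (fun y => dot (f y) (g y) : R^o) x v
  = dot (dsphere f x v) (g x) + dot (f x) (dsphere g x v).
Proof.
move=> hx df dg; have dfT := derivable_sphere_trmx df.
have dM := derivable_sphere_mulmx dfT dg.
have := dsphere_mulmx hx dfT dg; rewrite dsphere_trmx // => e.
transitivity (dsphere (fun y => (f y)^T *m g y) x v 0 0).
  by rewrite [in RHS]/dsphere derive_coord.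
by rewrite e mxE.
Qed.

End SphereCalculus.

(** * The Levi-Civita connection of the sphere *)

Section LeviCivita.
Context {R : realType} {d : nat}.
Local Notation E := 'cV[R]_d.+1.
Implicit Types x y u v w : E.

Lemma smooth_on_sphere (W : normedModType R) (f : E -> W) :
  smooth_on setT f -> smooth_sphere f.
Proof. by move=> sf x _; exists setT, f; split=> //; exact: openT. Qed.

Lemma smooth_sphere_mulmx m n p (f : E -> 'M[R]_(m, n))
    (g : E -> 'M[R]_(n, p)) :
  smooth_sphere f -> smooth_sphere g -> smooth_sphere (fun y => f y *m g y).
Proof.
move=> sf sg x hx.
have [U [f' [oU Ux sf' ff']]] := sf _ hx.
have [U' [g' [oU' Ux' sg' gg']]] := sg _ hx.
exists (U `&` U'), (fun y => f' y *m g' y); split; first exact: openI.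
- by split.
- move=> k; apply: Ck_on_mulmx; first exact: openI.
  + exact: sub_Ck_on (@subIsetl _ _ _) (sf' k).
  + exact: sub_Ck_on (@subIsetr _ _ _) (sg' k).
- by move=> y [Uy Uy'] hy; rewrite ff' // gg'.
Qed.

Lemma smooth_dot a : smooth_sphere (fun y => dot a y : R^o).
Proof.
apply: smooth_on_sphere => k; apply: (Ck_on_coord (F := fun y => a^T *m y)).
  exact: openT.
by apply: Ck_on_mulmx; [exact: openT|exact: Ck_on_cst|exact: Ck_on_id].
Qed.

Lemma vector_field_acs (J : E -> 'M[R]_d.+1) Y :
  almost_complex J -> vector_field Y -> vector_field (fun y => J y *m Y y).
Proof.
move=> hJ [sY tY]; split; first exact: smooth_sphere_mulmx (ac_smooth hJ) sY.
by move=> x hx; apply: (ac_tangent hJ) => //; exact: tY.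
Qed.

(** The tangential part of the constant field [v], namely
[y |-> v - <v, y> y], extends [v]; it is written with matrix products to fall
under [Ck_on_mulmx]. *)
Lemma tangent_extension x v : tangent x v ->
  exists2 Y, vector_field Y & Y x = v.
Proof.
move=> tv; pose Y y := v + y *m (- v^T *m y).
have YE y : Y y = v - dot v y *: y.
  by rewrite /Y mulNmx dot_mx mulmxN mul_mx_scalar.
exists Y; last by rewrite YE tv scale0r subr0.
split; last first.
  move=> y hy; rewrite /tangent /= YE dotBl dotZl.
  by move: hy; rewrite /sphere /= => ->; rewrite mulr1 subrr.
apply: smooth_on_sphere => k; have oT : open [set: E] by exact: openT.
apply: Ck_onD => //; first exact: Ck_on_cst.
apply: Ck_on_mulmx => //; first exact: Ck_on_id.
by apply: Ck_on_mulmx => //; [exact: Ck_on_cst|exact: Ck_on_id].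
Qed.

Definition tanproj x w := w - dot x w *: x.

Lemma tanproj_tangent x w : sphere x -> tangent x (tanproj x w).
Proof.
rewrite /tangent /sphere /= /tanproj dotBl dotZl => ->.
by rewrite mulr1 dotC subrr.
Qed.

Lemma dot_tanproj x w u : tangent x u -> dot (tanproj x w) u = dot w u.
Proof.
rewrite /tangent /= dotC => tu.
by rewrite /tanproj dotBl dotZl tu mulr0 subr0.
Qed.

Variables (nabla : E -> E -> (E -> E) -> E).
Hypothesis hnabla : levi_civita nabla.

(** Testing the torsion axiom on the linear functions [dot a] gives a vector
identity without second derivatives: [dot a] has derivative [dot a (Y y)] along
[Y], so the bracket of [X] and [Y] acts on it through [dY (X) - dX (Y)]. *)
Lemma torsion_free_vector x X Y :
  sphere x -> vector_field X -> vector_field Y ->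
  nabla x (X x) Y - nabla x (Y x) X = dsphere Y x (X x) - dsphere X x (Y x).
Proof.
move=> hx vX vY; have [[sX tX] [sY tY]] := (vX, vY).
have dlin a y v : sphere y -> tangent y v ->
    dsphere (fun z => dot a z : R^o) y v = dot a v.
  move=> hy tv; rewrite (@dsphere_dotl R d a id) ?dsphere_id //.
  exact: derivable_sphere_id.
have dfield a Z v : vector_field Z ->
    dsphere (fun y => dsphere (fun z => dot a z : R^o) y (Z y)) x v
    = dot a (dsphere Z x v).
  move=> [sZ tZ].
  rewrite -dsphere_dotl //; last exact: smooth_derivable.
  by apply: eq_dsphere => // y hy; rewrite dlin //; exact: tZ.
have tN : tangent x (nabla x (X x) Y - nabla x (Y x) X).
  rewrite /tangent /= dotBl.
  have /= -> := lc_tangent hnabla hx (tX _ hx) vY.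
  by have /= -> := lc_tangent hnabla hx (tY _ hx) vX; rewrite subrr.
suff e a : dot (nabla x (X x) Y - nabla x (Y x) X) a
    = dot (dsphere Y x (X x) - dsphere X x (Y x)) a.
  by apply/eqP; rewrite -subr_eq0; apply/eqP/dot_eq0; rewrite dotBl e subrr.
have e := lc_torsion_free hnabla hx vX vY (smooth_dot a).
rewrite dotC dotBl -!(dotC a) -(dfield a Y (X x) vY) -(dfield a X (Y x) vX).
exact: etrans (esym (dlin a x _ hx tN)) e.
Qed.

Let subr_swap (a b c e : R) : a - b = c - e -> a - c = b - e.
Proof. by move=> h; lra. Qed.

Let subr_opp (a b c e : R) : a + b = c + e -> c - a = - (e - b).
Proof. by move=> h; lra. Qed.

(** Both sides are metric and torsion free.  If [B] is their difference, the
form [<B (X, Y), W>] is symmetric in [X, Y] and antisymmetric in [Y, W], and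
such a form vanishes. *)
Theorem levi_civita_sphere x v Y :
  sphere x -> tangent x v -> vector_field Y ->
  nabla x v Y = tanproj x (dsphere Y x v).
Proof.
move=> hx tv vY.
pose B X Z := nabla x (X x) Z - tanproj x (dsphere Z x (X x)).
pose c X Z W := dot (B X Z) (W x).
have cE X Z W : vector_field W ->
    c X Z W = dot (nabla x (X x) Z) (W x) - dot (dsphere Z x (X x)) (W x).
  by move=> vW; rewrite /c dotBl dot_tanproj //; exact: vW.2.
have csym X Z W : vector_field X -> vector_field Z -> vector_field W ->
    c X Z W = c Z X W.
  move=> vX vZ vW; rewrite (cE X Z W vW) (cE Z X W vW).
  apply: subr_swap; rewrite -(dotBl (nabla _ _ _)) -(dotBl (dsphere _ _ _)).
  by rewrite torsion_free_vector.
have canti X Z W : vector_field X -> vector_field Z -> vector_field W ->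
    c X Z W = - c X W Z.
  move=> vX vZ vW; rewrite (cE X Z W vW) (cE X W Z vZ); apply: subr_opp.
  have dZ : derivable_sphere Z x (X x) by exact: smooth_derivable vZ.1 hx.
  have dW : derivable_sphere W x (X x) by exact: smooth_derivable vW.1 hx.
  rewrite [dot (dsphere W _ _) _]dotC [dot (nabla _ _ W) _]dotC.
  by rewrite -dsphere_dot // (lc_metric hnabla hx (vX.2 _ hx) vZ vW).
have [X vX Xx] := tangent_extension tv.
have c0 W : vector_field W -> c X Y W = 0.
  move=> vW; have : c X Y W = - c X Y W.
    rewrite {1}(csym X Y W) // (canti Y X W) // (csym Y W X) // (canti W Y X) //.
    by rewrite opprK (csym W X Y) // (canti X W Y).
  by move/eqP; rewrite -addr_eq0 -mulr2n mulrn_eq0 /= => /eqP.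
apply/eqP; rewrite -subr_eq0 -Xx -/(B X Y); apply/eqP.
have tB : tangent x (B X Y).
  rewrite /tangent /= dotBl; have /= -> := tanproj_tangent (dsphere Y x (X x)) hx.
  by rewrite subr0; apply: (lc_tangent hnabla) => //; exact: vX.2.
have [W vW Wx] := tangent_extension tB.
by apply: dot_eq0; rewrite -{2}Wx; exact: c0.
Qed.

End LeviCivita.

(** * Complex matrices in rectangular form *)

Section ComplexMatrices.
Context {R : realType}.

Lemma mx_col_ext (F : comNzRingType) m n (A B : 'M[F]_(m, n)) :
  (forall v : 'cV_n, A *m v = B *m v) -> A = B.
Proof.
move=> h; apply: trmx_inj; apply/row_matrixP => j.
by rewrite -!tr_col !colE h.
Qed.

Lemma mulii : 'i%C * 'i%C = -1 :> R[i].
Proof. by simpc. Qed.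

Lemma conj_i : Num.conj ('i%C : R[i]) = - 'i%C.
Proof. by apply/eqP; rewrite eq_complex /= oppr0 !eqxx. Qed.

Lemma trmxC_cplx m n (A : 'M[R]_(m, n)) : (cplx_mx A)^t* = cplx_mx A^T.
Proof.
apply/matrixP => i j; rewrite !mxE.
by apply/eqP; rewrite eq_complex /= oppr0 !eqxx.
Qed.

Lemma trmxC_D m n (A B : 'M[R[i]]_(m, n)) : (A + B)^t* = A^t* + B^t*.
Proof. by rewrite linearD /= map_mxD. Qed.

Lemma trmxC_sum m n (I : Type) (r : seq I) (A : I -> 'M[R[i]]_(m, n)) :
  (\sum_(k <- r) A k)^t* = \sum_(k <- r) (A k)^t*.
Proof. by rewrite raddf_sum /= (raddf_sum (map_mx Num.conj)). Qed.

Lemma trmxC_N m n (A : 'M[R[i]]_(m, n)) : (- A)^t* = - A^t*.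
Proof. by rewrite linearN /= map_mxN. Qed.

Lemma trmxC_Z m n (a : R[i]) (A : 'M[R[i]]_(m, n)) :
  (a *: A)^t* = Num.conj a *: A^t*.
Proof. by rewrite linearZ /= map_mxZ. Qed.

Lemma trmxC_1 n : (1%:M : 'M[R[i]]_n)^t* = 1%:M.
Proof. by rewrite trmx1 map_mx1. Qed.

Lemma cplx_mxD m n (A B : 'M[R]_(m, n)) :
  cplx_mx (A + B) = cplx_mx A + cplx_mx B.
Proof. exact: map_mxD. Qed.

Lemma cplx_mxN m n (A : 'M[R]_(m, n)) : cplx_mx (- A) = - cplx_mx A.
Proof. exact: map_mxN. Qed.

Lemma cplx_mxB m n (A B : 'M[R]_(m, n)) :
  cplx_mx (A - B) = cplx_mx A - cplx_mx B.
Proof. exact: map_mxB. Qed.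

Lemma cplx_mx1 n : cplx_mx (1%:M : 'M[R]_n) = 1%:M.
Proof. exact: map_mx1. Qed.

Lemma cplx_mx0 m n : cplx_mx (0 : 'M[R]_(m, n)) = 0.
Proof. exact: map_mx0. Qed.

Lemma cplx_mxZ m n (a : R) (A : 'M[R]_(m, n)) :
  cplx_mx (a *: A) = a%:C *: cplx_mx A.
Proof. exact: map_mxZ. Qed.

Lemma ReIm_mxE m n (A B : 'M[R]_(m, n)) (F : 'M[R[i]]_(m, n)) :
  F = cplx_mx A + 'i%C *: cplx_mx B -> Re_mx F = A /\ Im_mx F = B.
Proof. by rewrite {1}[F]cplx_mxReIm => /cplx_mx_inj. Qed.

Lemma Re_rect m n (A B : 'M[R]_(m, n)) :
  Re_mx (cplx_mx A + 'i%C *: cplx_mx B) = A.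
Proof. by have [] := ReIm_mxE (erefl (cplx_mx A + 'i%C *: cplx_mx B)). Qed.

Lemma Im_rect m n (A B : 'M[R]_(m, n)) :
  Im_mx (cplx_mx A + 'i%C *: cplx_mx B) = B.
Proof. by have [] := ReIm_mxE (erefl (cplx_mx A + 'i%C *: cplx_mx B)). Qed.

Lemma cplx_rect_congr m n (A B A' B' : 'M[R]_(m, n)) : A = A' -> B = B' ->
  cplx_mx A + 'i%C *: cplx_mx B = cplx_mx A' + 'i%C *: cplx_mx B'.
Proof. by move=> -> ->. Qed.

Lemma cplx_rectD m n (A B C D : 'M[R]_(m, n)) :
  (cplx_mx A + 'i%C *: cplx_mx B) + (cplx_mx C + 'i%C *: cplx_mx D)
  = cplx_mx (A + C) + 'i%C *: cplx_mx (B + D).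
Proof. by rewrite addrACA -scalerDr !cplx_mxD. Qed.

Lemma cplx_rect_mulmx m n p (A B : 'M[R]_(m, n)) (C D : 'M[R]_(n, p)) :
  (cplx_mx A + 'i%C *: cplx_mx B) *m (cplx_mx C + 'i%C *: cplx_mx D)
  = cplx_mx (A *m C - B *m D) + 'i%C *: cplx_mx (A *m D + B *m C).
Proof.
rewrite mulmxDl !mulmxDr -!scalemxAl -!scalemxAr scalerA mulii scaleN1r.
rewrite cplx_mxB cplx_mxD !cplx_mxM scalerDr.
by rewrite [X in _ + X = _]addrC addrACA.
Qed.

Lemma trmxC_rect m n (A B : 'M[R]_(m, n)) :
  (cplx_mx A + 'i%C *: cplx_mx B)^t*
  = cplx_mx A^T + 'i%C *: cplx_mx (- B^T).
Proof.
by rewrite trmxC_D trmxC_Z conj_i !trmxC_cplx cplx_mxN scalerN scaleNr.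
Qed.

Lemma hermitian_ReIm n (F : 'M[R[i]]_n) : F^t* = F ->
  (Re_mx F)^T = Re_mx F /\ (Im_mx F)^T = - Im_mx F.
Proof.
move=> hF; have : cplx_mx (Re_mx F)^T + 'i%C *: cplx_mx (- (Im_mx F)^T)
    = cplx_mx (Re_mx F) + 'i%C *: cplx_mx (Im_mx F).
  by rewrite -trmxC_rect -cplx_mxReIm.
by move=> /cplx_mx_inj[-> /eqP]; rewrite eqr_oppLR => /eqP.
Qed.

End ComplexMatrices.

(** * Derivatives of complex-valued maps on the sphere *)

Section ComplexDifferential.
Context {R : realType} {d : nat}.
Local Notation E := 'cV[R]_d.+1.
Implicit Types x v : E.

(** On square matrices this is [dsphereC]; sections of vector bundles need the
rectangular case. *)
Definition dsphere_cplx m n (F : E -> 'M[R[i]]_(m, n)) x v : 'M[R[i]]_(m, n) :=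
  cplx_mx (dsphere (fun y => Re_mx (F y)) x v)
  + 'i%C *: cplx_mx (dsphere (fun y => Im_mx (F y)) x v).

Definition derivable_cplx m n (F : E -> 'M[R[i]]_(m, n)) x v :=
  derivable_sphere (fun y => Re_mx (F y)) x v /\
  derivable_sphere (fun y => Im_mx (F y)) x v.

Lemma dsphere_cplx_rect m n (A B : E -> 'M[R]_(m, n)) x v :
  dsphere_cplx (fun y => cplx_mx (A y) + 'i%C *: cplx_mx (B y)) x v
  = cplx_mx (dsphere A x v) + 'i%C *: cplx_mx (dsphere B x v).
Proof.
apply: cplx_rect_congr; congr (dsphere _ x v).
  by apply/funext => y; rewrite Re_rect.
by apply/funext => y; rewrite Im_rect.
Qed.

Lemma derivable_cplx_rect m n (A B : E -> 'M[R]_(m, n)) x v :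
  derivable_sphere A x v -> derivable_sphere B x v ->
  derivable_cplx (fun y => cplx_mx (A y) + 'i%C *: cplx_mx (B y)) x v.
Proof.
move=> dA dB; split.
  have -> // : (fun y => Re_mx (cplx_mx (A y) + 'i%C *: cplx_mx (B y))) = A.
  by apply/funext => y; rewrite Re_rect.
have -> // : (fun y => Im_mx (cplx_mx (A y) + 'i%C *: cplx_mx (B y))) = B.
by apply/funext => y; rewrite Im_rect.
Qed.

Lemma eq_dsphere_cplx m n (F F' : E -> 'M[R[i]]_(m, n)) x v : sphere x ->
  (forall y, sphere y -> F y = F' y) ->
  dsphere_cplx F x v = dsphere_cplx F' x v.
Proof.
move=> hx FF'; apply: cplx_rect_congr.
  by apply: eq_dsphere => // y hy; rewrite FF'.
by apply: eq_dsphere => // y hy; rewrite FF'.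
Qed.

Lemma dsphere_cplx_mulmx m n p (F : E -> 'M[R[i]]_(m, n))
    (G : E -> 'M[R[i]]_(n, p)) x v : sphere x ->
  derivable_cplx F x v -> derivable_cplx G x v ->
  dsphere_cplx (fun y => F y *m G y) x v
  = dsphere_cplx F x v *m G x + F x *m dsphere_cplx G x v.
Proof.
move=> hx [dF dF'] [dG dG'].
pose a y := Re_mx (F y); pose b y := Im_mx (F y).
pose r y := Re_mx (G y); pose s y := Im_mx (G y).
have -> : (fun y => F y *m G y) = (fun y =>
    cplx_mx (a y *m r y - b y *m s y)
    + 'i%C *: cplx_mx (a y *m s y + b y *m r y)).
  by apply/funext => y; rewrite -cplx_rect_mulmx -!cplx_mxReIm.
rewrite dsphere_cplx_rect.
rewrite (dsphereB (derivable_sphere_mulmx dF dG)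
  (derivable_sphere_mulmx dF' dG')).
rewrite (dsphereD (derivable_sphere_mulmx dF dG')
  (derivable_sphere_mulmx dF' dG)).
rewrite (dsphere_mulmx hx dF dG) (dsphere_mulmx hx dF' dG').
rewrite (dsphere_mulmx hx dF dG') (dsphere_mulmx hx dF' dG).
rewrite [in RHS](cplx_mxReIm (G x)) [in RHS](cplx_mxReIm (F x)).
rewrite [X in _ = X + _]cplx_rect_mulmx [X in _ = _ + X]cplx_rect_mulmx.
rewrite [RHS]cplx_rectD.
by apply: cplx_rect_congr; [rewrite opprD addrACA|rewrite addrACA].
Qed.

Lemma dsphere_cplx_hermitian (F : E -> 'M[R[i]]_d.+1) x v : sphere x ->
  (forall y, sphere y -> (F y)^t* = F y) -> derivable_cplx F x v ->
  (dsphere_cplx F x v)^t* = dsphere_cplx F x v.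
Proof.
move=> hx hF [dR dI]; rewrite trmxC_rect; apply: cplx_rect_congr.
  rewrite -(dsphere_trmx dR).
  by apply: eq_dsphere => // y /hF/hermitian_ReIm[].
rewrite -(dsphere_trmx dI) -(dsphereN (derivable_sphere_trmx dI)).
by apply: eq_dsphere => // y /hF/hermitian_ReIm[_ ->]; rewrite opprK.
Qed.

End ComplexDifferential.

(** * The orthogonal projections onto [T01] and onto the image of [Pperp] *)

Section Projections.
Context {R : realType} {d : nat}.
Local Notation E := 'cV[R]_d.+1.

Lemma dot_mulmxl (A : 'M[R]_d.+1) (u w : E) : dot (A *m u) w = dot u (A^T *m w).
Proof. by rewrite /dot trmx_mul mulmxA. Qed.

Lemma real_complex_half : (2^-1 : R)%:C = 2^-1 :> R[i].
Proof. by rewrite (fmorphV (real_complex R)) rmorph_nat. Qed.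

Lemma half_sum (V : lmodType R[i]) (a b c : V) :
  2^-1 *: ((a + b) + (a - c)) = a + 2^-1 *: (b - c).
Proof.
rewrite addrACA scalerDr; congr (_ + _).
by rewrite -[in LHS](scale1r a) -scalerDl scalerA mulVf ?scale1r.
Qed.

Variable J : E -> 'M[R]_d.+1.
Hypothesis hJ : almost_complex J.

(** [J] need not be orthogonal, so that [K01] is an oblique projection; up to the
normal direction, [K01 + K01^t* - 1] is [i] times the skew part of [J]. *)
Definition skewJ (y : E) := 2^-1 *: (J y - (J y)^T).

(** As [skewJ y] is skew, this is [y y^T + S^T S], a positive semidefinite
matrix. *)
Definition gramJ (y : E) := y *m y^T - skewJ y *m skewJ y.

Definition gramJV (y : E) := (\det (gramJ y))^-1 *: \adj (gramJ y).

Definition Q01 (y : E) := orth_proj (T01 J y).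

Section Pointwise.
Variable x : E.
Hypothesis hx : sphere x.
Local Notation S := (skewJ x).
Local Notation Q := (Q01 x).

Lemma sphere_mx : x^T *m x = 1%:M.
Proof. by rewrite dot_mx; move: hx; rewrite /sphere /= => ->. Qed.

Lemma mul_trx_J : x^T *m J x = 0.
Proof.
apply: mx_col_ext => v; rewrite mul0mx.
have -> : v = tanproj x v + dot x v *: x by rewrite /tanproj subrK.
rewrite mulmxDr -scalemxAr -!mulmxA (ac_normal hJ hx) mulmx0 scaler0 addr0.
by apply/tangentP/(ac_tangent hJ hx)/tanproj_tangent.
Qed.

Lemma skewJ_tr : S^T = - S.
Proof.
by rewrite /skewJ linearZ /= linearB /= trmxK -scalerN opprB.
Qed.

Lemma skewJ_x : S *m x = 0.
Proof.
rewrite /skewJ -scalemxAl mulmxBl (ac_normal hJ hx) sub0r.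
by rewrite -[_ *m x]trmxK trmx_mul trmxK mul_trx_J trmx0 oppr0 scaler0.
Qed.

Lemma mul_trx_skewJ : x^T *m S = 0.
Proof.
by rewrite -[S]opprK -skewJ_tr mulmxN -trmx_mul skewJ_x trmx0 oppr0.
Qed.

(** A vector [v] in the kernel is orthogonal to [x] and killed by the skew part,
so [J v = J^T v]; then [|J v|^2 = <v, J J v> = - |v|^2] forces [v = 0]. *)
Lemma gramJ_unit : gramJ x \in unitmx.
Proof.
rewrite unitmxE unitfE; apply/det0P => -[u u0 uG].
pose v := u^T; have vv : dot v v != 0.
  by apply: contra_neq u0 => /dot_eq0 /(congr1 trmx); rewrite trmxK trmx0.
have : dot (gramJ x *m v) v = 0.
  rewrite dot_mulmxl /gramJ linearB /= !trmx_mul trmxK skewJ_tr mulNmx mulmxN opprK.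
  by rewrite /dot /v trmxK mulmxA uG mul0mx mxE.
have -> : gramJ x *m v = dot x v *: x - S *m (S *m v).
  by rewrite /gramJ mulmxBl -!mulmxA dot_mx mul_mx_scalar.
rewrite dotBl dotZl dot_mulmxl skewJ_tr mulNmx [dot _ (- _)]dotC dotNl opprK.
rewrite -expr2 => /eqP; rewrite paddr_eq0 ?sqr_ge0 ?dot_ge0 //.
rewrite sqrf_eq0 => /andP[/eqP xv /eqP/dot_eq0 Sv].
have JJ : J x *m v = (J x)^T *m v.
  apply/eqP; rewrite -subr_eq0 -mulmxBl; move: Sv; rewrite /skewJ -scalemxAl.
  by move/eqP; rewrite scaler_eq0 invr_eq0 pnatr_eq0.
have tv : tangent x v by rewrite /tangent /= dotC.
have : dot (J x *m v) (J x *m v) = - dot v v.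
  rewrite {1}JJ dot_mulmxl trmxK (ac_square hJ hx tv).
  by rewrite dotC dotNl.
move=> e; have := dot_ge0 (J x *m v); rewrite e oppr_ge0 => le0.
by move: vv; rewrite eq_le le0 dot_ge0.
Qed.

Lemma Q01_idem : Q *m Q = Q.
Proof. by have [] := T01_orth_projP hJ hx. Qed.

Lemma Q01_adj : Q^t* = Q.
Proof. by have [] := T01_orth_projP hJ hx. Qed.

Lemma Q01P v : T01 J x v <-> Q *m v = v.
Proof. by have [_ _] := T01_orth_projP hJ hx; apply. Qed.

Lemma Q01_K01 : Q *m K01 J x = K01 J x.
Proof.
apply: mx_col_ext => v; rewrite -mulmxA; apply/Q01P/(T01P hJ hx).
by rewrite mulmxA (K01_idem hJ hx).
Qed.

Lemma K01_Q01 : K01 J x *m Q = Q.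
Proof.
apply: mx_col_ext => v; rewrite -mulmxA; apply/(T01P hJ hx)/Q01P.
by rewrite mulmxA Q01_idem.
Qed.

Lemma trx_Q01 : cplx_mx x^T *m Q = 0.
Proof. by rewrite -K01_Q01 mulmxA (xK01 hJ hx) mul0mx. Qed.

Lemma Q01_x : Q *m cplx_mx x = 0.
Proof.
rewrite -[LHS]trmxCK trmxC_mul Q01_adj trmxC_cplx trx_Q01.
by rewrite trmx0 map_mx0.
Qed.

Lemma K01_adj_sum :
  K01 J x + (K01 J x)^t* - 1%:M = 'i%C *: cplx_mx S - cplx_mx (x *m x^T).
Proof.
rewrite /K01 trmxC_Z trmxC_D trmxC_Z conj_i !trmxC_cplx.
rewrite fmorphV /= rmorph_nat -scalerDr.
rewrite linearB /= trmx1 trmx_mul trmxK scaleNr half_sum -scalerBr.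
rewrite scalerA mulrC -scalerA -real_complex_half -cplx_mxB -cplx_mxZ cplx_mxB cplx_mx1.
by rewrite addrAC [X in X + _]addrAC subrr sub0r addrC.
Qed.

(** For an idempotent [K] with orthogonal range projection [Q], one has
[Q *m K = K] and [Q *m K^t* = (K *m Q)^t* = Q], hence
[Q *m (K + K^t* - 1) = K]. *)
Lemma Q01_skewJ : 'i%C *: (Q *m cplx_mx S) = K01 J x.
Proof.
rewrite scalemxAr; have := congr1 (mulmx Q) K01_adj_sum.
rewrite !mulmxBr mulmxDr Q01_K01 mulmx1.
rewrite -[Q in Q *m _^t*]Q01_adj -trmxC_mul K01_Q01 Q01_adj addrK => ->.
by rewrite cplx_mxM mulmxA Q01_x mul0mx subr0.
Qed.

(** Multiplying the previous identity by the skew part turns the complex factor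
of [Q] into a real symmetric one, which is easier to invert. *)
Lemma Q01_gramJ :
  Q *m cplx_mx (gramJ x)
  = cplx_mx (- 2^-1 *: (J x *m S)) + 'i%C *: cplx_mx (2^-1 *: S).
Proof.
have -> : Q *m cplx_mx (gramJ x) = 'i%C *: (K01 J x *m cplx_mx S).
  rewrite -Q01_skewJ -scalemxAl scalerA mulii scaleN1r.
  by rewrite cplx_mxB mulmxBr !cplx_mxM mulmxA Q01_x mul0mx sub0r mulmxA.
rewrite /K01 -scalemxAl mulmxDl -scalemxAl -!cplx_mxM.
rewrite mulmxBl mul1mx -mulmxA mul_trx_skewJ mulmx0 subr0.
rewrite scalerA mulrC -scalerA scalerDr scalerA mulii scaleN1r scaleNr cplx_mxN.
rewrite -real_complex_half scalerDr scalerN -!cplx_mxZ addrC; congr (- _ + _).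
by rewrite (cplx_mxZ _ S) scalerA [RHS]scalerA [X in X *: _ = _]mulrC.
Qed.

Lemma Q01E :
  Q = cplx_mx (- 2^-1 *: (J x *m S *m gramJV x))
      + 'i%C *: cplx_mx (2^-1 *: (S *m gramJV x)).
Proof.
have -> : Q = Q *m cplx_mx (gramJ x) *m cplx_mx (invmx (gramJ x)).
  by rewrite -mulmxA -cplx_mxM mulmxV ?gramJ_unit // cplx_mx1 mulmx1.
rewrite Q01_gramJ mulmxDl -scalemxAl -!cplx_mxM /invmx gramJ_unit.
by apply: cplx_rect_congr; exact: esym (scalemxAl _ _ _).
Qed.

Lemma PperpE : Pperp J x = Q + cplx_mx (x *m x^T).
Proof.
apply: (is_orth_proj_uniq (Pperp_orth_projP hJ hx)).
set N := cplx_mx (x *m x^T).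
have QN : Q *m N = 0 by rewrite /N cplx_mxM mulmxA Q01_x mul0mx.
have NQ : N *m Q = 0 by rewrite /N cplx_mxM -mulmxA trx_Q01 mulmx0.
have NN : N *m N = N.
  by rewrite /N -cplx_mxM mulmxA -[x *m _ *m x]mulmxA sphere_mx mulmx1.
split.
- by rewrite mulmxDl !mulmxDr Q01_idem QN NQ NN addr0 add0r.
- by rewrite trmxC_D Q01_adj trmxC_cplx trmx_mul trmxK.
- move=> v; split=> [[a [b [/Q01P Qa /(complexify_normalP _ hx) Nb ->]]]|h].
    rewrite mulmxDr ![(Q + N) *m _]mulmxDl Qa Nb.
    by rewrite -[in _ *m a]Qa -[in Q *m b]Nb 2!mulmxA NQ QN !mul0mx addr0 add0r.
  exists (Q *m v), (N *m v); split.
  + by apply/Q01P; rewrite mulmxA Q01_idem.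
  + by apply/(complexify_normalP _ hx); rewrite mulmxA NN.
  + by rewrite -mulmxDl.
Qed.

Lemma Pperp_idem : Pperp J x *m Pperp J x = Pperp J x.
Proof. by have [] := Pperp_orth_projP hJ hx. Qed.

Lemma Pperp_adj : (Pperp J x)^t* = Pperp J x.
Proof. by have [] := Pperp_orth_projP hJ hx. Qed.

Lemma Pperp_x : Pperp J x *m cplx_mx x = cplx_mx x.
Proof.
rewrite PperpE mulmxDl Q01_x add0r -cplx_mxM -mulmxA sphere_mx.
by rewrite mulmx1.
Qed.

Lemma Pperp_T01 v : T01 J x v -> Pperp J x *m v = v.
Proof.
move=> tv; have Qv : Q *m v = v by exact/Q01P.
rewrite -Qv PperpE mulmxDl mulmxA Q01_idem cplx_mxM mulmxA.
by rewrite -[_ *m _ *m Q]mulmxA trx_Q01 mulmx0 mul0mx addr0.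
Qed.

Lemma T01_mem w : tangent x w ->
  T01 J x (cplx_mx w + 'i%C *: cplx_mx (J x *m w)).
Proof.
move=> tw; split.
  by split; rewrite /= ?Re_rect ?Im_rect //; exact: (ac_tangent hJ).
rewrite mulmxDr -scalemxAr -!cplx_mxM (ac_square hJ hx tw) cplx_mxN.
by rewrite scalerN scalerDr scaleNr scalerA mulNr mulii opprK scale1r addrC.
Qed.

End Pointwise.

(** [Q01E] holds at every point of the sphere, which is enough for
differentiating along it. *)
Lemma derivable_Pperp x v : sphere x -> derivable_cplx (Pperp J) x v.
Proof.
move=> hx; have dJ : derivable_sphere J x v.
  by apply: smooth_derivable => //; exact: ac_smooth hJ.
have dS : derivable_sphere skewJ x v.
  exact: derivableZ (derivableB dJ (derivable_sphere_trmx dJ)).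
have did : derivable_sphere (@id E) x v by exact: derivable_sphere_id.
have dN : derivable_sphere (fun y : E => y *m y^T) x v.
  exact: derivable_sphere_mulmx did (derivable_sphere_trmx did).
have dG : derivable_sphere gramJ x v.
  exact: derivableB dN (derivable_sphere_mulmx dS dS).
have dH : derivable_sphere gramJV x v.
  by apply: (derivable_invmx dG); rewrite /= retract_id //; exact: gramJ_unit.
pose A y := - 2^-1 *: (J y *m skewJ y *m gramJV y) + y *m y^T.
pose B y := 2^-1 *: (skewJ y *m gramJV y).
have PE y : sphere y -> Re_mx (Pperp J y) = A y /\ Im_mx (Pperp J y) = B y.
  move=> hy; apply: ReIm_mxE; rewrite PperpE // Q01E // /A cplx_mxD.
  by rewrite addrAC.
have dA : derivable_sphere A x v.
  have dJSH := derivable_sphere_mulmx (derivable_sphere_mulmx dJ dS) dH.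
  exact: derivableD (derivableZ dJSH) dN.
have dB : derivable_sphere B x v.
  exact: derivableZ (derivable_sphere_mulmx dS dH).
split.
  by apply: eq_derivable_sphere dA => // y /PE[->].
by apply: eq_derivable_sphere dB => // y /PE[_ ->].
Qed.

End Projections.

(** * The pullback of the Kaehler form *)

Section PullbackFormula.
Context {R : realType} {d : nat}.
Local Notation E := 'cV[R]_d.+1.
Variable J : E -> 'M[R]_d.+1.
Hypothesis hJ : almost_complex J.
Variable x : E.
Hypothesis hx : sphere x.
Local Notation P := (Pperp J x).
Local Notation Q := (Q01 J x).
Local Notation N := (1%:M - Pperp J x).

Lemma compl_tanproj w : N *m cplx_mx w = N *m cplx_mx (tanproj x w).
Proof.
have Nx : N *m cplx_mx x = 0 by rewrite mulmxBl Pperp_x // mul1mx subrr.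
by rewrite /tanproj cplx_mxB cplx_mxZ [RHS]mulmxBr -scalemxAr Nx scaler0 subr0.
Qed.

Lemma compl_idem : N *m N = N.
Proof.
by rewrite mulmxBr mulmx1 mulmxBl mul1mx Pperp_idem // subrr subr0.
Qed.

Lemma compl_adj : N^t* = N.
Proof. by rewrite trmxC_D trmxC_N trmxC_1 Pperp_adj. Qed.

Lemma imaginary_part (p r m : R) :
  (2 * 'i%C)^-1 * (p%:C - (r%:C + 'i%C * m%:C)
                   - (p%:C - (r%:C + 'i%C * (- m)%:C))) = (- m)%:C :> R[i].
Proof.
have i0 : 'i%C != 0 :> R[i] by rewrite eq_complex /= oner_eq0 andbF.
have -> : (- m)%:C = - (m%:C) :> R[i] by rewrite -rmorphN.
have -> : p%:C - (r%:C + 'i%C * m%:C) - (p%:C - (r%:C + 'i%C * - m%:C))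
    = (2 * 'i%C) * (- m%:C) :> R[i] by ring.
by rewrite mulKf // mulf_neq0 // pnatr_eq0.
Qed.

(** The hermitian product of [(1 - P) u] and [(1 - P) w] is
[<u, w> - <u, Q w>]; its symmetric real part drops out, and the skewness of
[Im_mx Q] gives the sign. *)
Lemma compl_form_nu u w a b : a = N *m cplx_mx u -> b = N *m cplx_mx w ->
  tangent x u -> tangent x w ->
  (2 * 'i%C)^-1 * ((a^t* *m b - b^t* *m a) 0 0) = (nu J x u w)%:C.
Proof.
move=> -> -> tu tw.
have herm (p q : E) : tangent x q ->
    (N *m cplx_mx p)^t* *m (N *m cplx_mx q)
    = cplx_mx (p^T *m q) - cplx_mx p^T *m Q *m cplx_mx q.
  move=> tq; rewrite trmxC_mul compl_adj mulmxA -[_ *m N *m N]mulmxA compl_idem.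
  rewrite trmxC_cplx PperpE // opprD addrA mulmxBr mulmxBl mulmxBr mulmx1 mulmxBl.
  rewrite -!cplx_mxM -!mulmxA.
  have -> : x^T *m q = 0 by exact/tangentP.
  by rewrite !mulmx0 cplx_mx0 subr0.
have [Rsym Msym] := hermitian_ReIm (Q01_adj hJ hx).
have quad (p q : E) : (cplx_mx p^T *m Q *m cplx_mx q) 0 0
    = (dot p (Re_mx Q *m q))%:C + 'i%C * (dot p (Im_mx Q *m q))%:C.
  rewrite {1}[Q]cplx_mxReIm mulmxDr mulmxDl -scalemxAr -scalemxAl -!cplx_mxM.
  by rewrite -!mulmxA !dot_mx !mxE eqxx !mulr1n.
have lin (p q : E) : cplx_mx (p^T *m q) 0 0 = (dot p q)%:C by rewrite mxE.
rewrite (herm _ _ tw) (herm _ _ tu).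
have e4 (A B C D : 'M[R[i]]_1) :
    (A - B - (C - D)) 0 0 = A 0 0 - B 0 0 - (C 0 0 - D 0 0) by rewrite !mxE.
rewrite e4 !quad !lin (dotC w u).
rewrite -[dot w (Re_mx Q *m u)]dotC -[dot w (Im_mx Q *m u)]dotC.
have -> : dot (Re_mx Q *m u) w = dot u (Re_mx Q *m w) by rewrite dot_mulmxl Rsym.
have nuE : nu J x u w = - dot u (Im_mx Q *m w).
  by rewrite /nu dot_mulmxl -/Q Msym mulNmx [LHS]dotC dotNl dotC.
have -> : dot (Im_mx Q *m u) w = - dot u (Im_mx Q *m w) by rewrite -nuE.
by rewrite nuE imaginary_part.
Qed.

(** Multiplying both vectors by the phase [i] leaves the form unchanged. *)
Lemma imag_form_nu u w a b :
  a = 'i%C *: (N *m cplx_mx u) -> b = 'i%C *: (N *m cplx_mx w) ->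
  tangent x u -> tangent x w ->
  (2 * 'i%C)^-1 * ((a^t* *m b - b^t* *m a) 0 0) = (nu J x u w)%:C.
Proof.
have isq (p q : 'cV[R[i]]_d.+1) : ('i%C *: p)^t* *m ('i%C *: q) = p^t* *m q.
  rewrite trmxC_Z conj_i -scalemxAl -scalemxAr scalerA mulNr mulii opprK.
  by rewrite scale1r.
move=> -> ->; rewrite (isq (N *m cplx_mx u) (N *m cplx_mx w)).
rewrite (isq (N *m cplx_mx w) (N *m cplx_mx u)); exact: compl_form_nu.
Qed.

(** The sum fixes the basis, hence [T01], and has its columns in [T01]; two
hermitian matrices with this property agree. *)
Lemma Q01_basis m (e : 'I_m -> 'cV[R[i]]_d.+1) :
  orthonormal_basis (T01 J x) e -> Q = \sum_k e k *m (e k)^t*.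
Proof.
move=> [eT eo es]; pose T := \sum_k e k *m (e k)^t*.
have QT : Q *m T = T.
  by rewrite mulmx_sumr; apply: eq_bigr => k _; rewrite mulmxA (Q01P hJ hx _).1.
have Te l : T *m e l = e l.
  rewrite mulmx_suml (bigD1 l) //= big1 ?addr0 => [|k kl].
    rewrite -mulmxA [_ *m e l]mx11_scalar.
    have := eo l l; rewrite /cdot => ->.
    by rewrite eqxx mulmx1.
  rewrite -mulmxA [_ *m e l]mx11_scalar; have := eo l k; rewrite /cdot => ->.
  by rewrite eq_sym (negPf kl) raddf0 mulmx0.
have TQ : T *m Q = Q.
  apply: mx_col_ext => v; rewrite -mulmxA.
  have /es[c ->] : T01 J x (Q *m v).
    by apply/(Q01P hJ hx); rewrite mulmxA Q01_idem.
  by rewrite mulmx_sumr; apply: eq_bigr => k _; rewrite -scalemxAr Te.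
have Th : T^t* = T.
  rewrite trmxC_sum; apply: eq_bigr => k _.
  by rewrite trmxC_mul trmxCK.
by rewrite -[LHS](Q01_adj hJ hx) -TQ trmxC_mul Th (Q01_adj hJ hx).
Qed.

Lemma trace_Q01_basis m (e : 'I_m -> 'cV[R[i]]_d.+1) (A B : 'M[R[i]]_d.+1) :
  orthonormal_basis (T01 J x) e -> A^t* = A ->
  \tr (P *m A *m B)
  = \sum_k ((A *m e k)^t* *m (B *m e k)) 0 0
    + ((A *m cplx_mx x)^t* *m (B *m cplx_mx x)) 0 0.
Proof.
move=> he hA; have tr1 (v : 'cV[R[i]]_d.+1) :
    \tr (v *m v^t* *m A *m B) = ((A *m v)^t* *m (B *m v)) 0 0.
  by rewrite -!mulmxA mxtrace_mulC trmxC_mul hA -!mulmxA /mxtrace big_ord1.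
rewrite PperpE // (Q01_basis he) !mulmxDl linearD /= cplx_mxM -trmxC_cplx tr1.
congr (_ + _).
by rewrite !mulmx_suml raddf_sum /=; apply: eq_bigr => k _; rewrite tr1.
Qed.

Let eq_add (a a' b b' : R[i]) : a = a' -> b = b' -> a + b = a' + b'.
Proof. by move=> -> ->. Qed.

Lemma kaehler_basis m (e : 'I_m -> 'cV[R[i]]_d.+1) (A B : 'M[R[i]]_d.+1) :
  orthonormal_basis (T01 J x) e -> A^t* = A -> B^t* = B ->
  kaehler P A B
  = \sum_k (2 * 'i%C)^-1 * (((A *m e k)^t* *m (B *m e k)
                             - (B *m e k)^t* *m (A *m e k)) 0 0)
    + (2 * 'i%C)^-1
      * (((A *m cplx_mx x)^t* *m (B *m cplx_mx x)
          - (B *m cplx_mx x)^t* *m (A *m cplx_mx x)) 0 0).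
Proof.
move=> he hA hB.
have subE (C D : 'M[R[i]]_1) : (C - D) 0 0 = C 0 0 - D 0 0 by rewrite !mxE.
rewrite /kaehler linearB /= (trace_Q01_basis B he hA) (trace_Q01_basis A he hB).
have split4 (a b c p f : R[i]) :
  a * (b + c - (p + f)) = a * (b - p) + a * (c - f) by ring.
apply: (etrans (split4 _ _ _ _ _)); rewrite -sumrB mulr_sumr.
apply: eq_add; last by rewrite subE.
by apply: eq_bigr => k _; rewrite subE.
Qed.

Local Notation dP := (dsphere_cplx (Pperp J) x).

(** Differentiate [P *m s = s]. *)
Lemma dPperp_section (s : E -> 'cV[R[i]]_d.+1) v :
  derivable_cplx s x v -> (forall y, sphere y -> Pperp J y *m s y = s y) ->
  dP v *m s x = N *m dsphere_cplx s x v.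
Proof.
move=> ds Ps.
have dPv : derivable_cplx (Pperp J) x v by exact: derivable_Pperp.
have e := dsphere_cplx_mulmx hx dPv ds.
rewrite mulmxBl mul1mx; apply/eqP; rewrite eq_sym subr_eq -e; apply/eqP.
by apply: eq_dsphere_cplx => // y hy; rewrite Ps.
Qed.

Lemma dPperp_x v : tangent x v -> dP v *m cplx_mx x = N *m cplx_mx v.
Proof.
pose s (y : E) := cplx_mx y + 'i%C *: cplx_mx (0 : E).
have sE y : s y = cplx_mx y by rewrite /s cplx_mx0 scaler0 addr0.
have d0 : derivable_sphere (cst (0 : E)) x v by exact: derivable_cst.
have did : derivable_sphere (@id E) x v by exact: derivable_sphere_id.
move=> tv; rewrite -sE dPperp_section.
- rewrite dsphere_cplx_rect dsphere_id //.
  have -> : dsphere (fun=> 0 : E) x v = 0 by exact: derive_cst.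
  by rewrite cplx_mx0 scaler0 addr0.
- exact: derivable_cplx_rect did d0.
- by move=> y hy; rewrite sE; apply: Pperp_x.
Qed.

Variables (nabla : E -> E -> (E -> E) -> E).
Hypothesis hnabla : levi_civita nabla.

(** Modulo [T01] and the normal line, the derivative of [Z + i J Z] is
[i (nabla J) Z], because [nabla Z + i J (nabla Z)] lies in [T01]. *)
Lemma dPperp_T01 v Z : tangent x v -> vector_field Z ->
  dP v *m (cplx_mx (Z x) + 'i%C *: cplx_mx (J x *m Z x))
  = 'i%C *: (N *m cplx_mx (nablaJ nabla J x v Z)).
Proof.
move=> tv vZ; have vJZ := vector_field_acs hJ vZ.
pose s (y : E) := cplx_mx (Z y) + 'i%C *: cplx_mx (J y *m Z y).
have dZ : derivable_sphere Z x v by exact: smooth_derivable vZ.1 hx.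
have dJZ : derivable_sphere (fun y => J y *m Z y) x v.
  exact: smooth_derivable vJZ.1 hx.
rewrite -/(s x) dPperp_section; first last.
- by move=> y hy; exact: (Pperp_T01 hJ hy (T01_mem hJ hy (vZ.2 _ hy))).
- exact: derivable_cplx_rect dZ dJZ.
rewrite dsphere_cplx_rect mulmxDr -scalemxAr.
rewrite (compl_tanproj (dsphere Z x v)) [in X in _ + X]compl_tanproj.
rewrite -!(levi_civita_sphere hnabla) //.
have -> : nabla x v (fun y => J y *m Z y)
  = nablaJ nabla J x v Z + J x *m nabla x v Z.
  by rewrite /nablaJ subrK.
rewrite cplx_mxD mulmxDr scalerDr addrCA -[RHS]addr0; congr (_ + _).
rewrite scalemxAr -mulmxDr mulmxBl mul1mx Pperp_T01 ?subrr //.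
by apply/T01_mem => //; exact: (lc_tangent hnabla hx tv vZ).
Qed.

(** The basis of [T01] contributes the sum, the normal vector [x] the last term. *)
Lemma pullback_kaehler_Pperp X Y m (Z : 'I_m -> E -> E) :
  tangent x X -> tangent x Y -> (forall k, vector_field (Z k)) ->
  orthonormal_basis (T01 J x)
    (fun k => cplx_mx (Z k x) + 'i%C *: cplx_mx (J x *m Z k x)) ->
  pullback_kaehler (Pperp J) x X Y =
    (\sum_k nu J x (nablaJ nabla J x X (Z k)) (nablaJ nabla J x Y (Z k))
     + nu J x X Y)%:C.
Proof.
move=> tX tY vZ hZ.
have dPh v : (dP v)^t* = dP v.
  apply: dsphere_cplx_hermitian => //; last exact: derivable_Pperp.
  by move=> y hy; exact: Pperp_adj.
have tN v k : tangent x v -> tangent x (nablaJ nabla J x v (Z k)).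
  move=> tv; have vJZ := vector_field_acs hJ (vZ k).
  have nt W : vector_field W -> tangent x (nabla x v W).
    exact: (lc_tangent hnabla hx tv).
  rewrite /tangent /= /nablaJ dotBl; have /= -> := nt _ vJZ.
  by have /= -> := ac_tangent hJ hx (nt _ (vZ k)); rewrite subrr.
have hk := kaehler_basis hZ (dPh X) (dPh Y).
apply: (etrans hk); rewrite rmorphD rmorph_sum.
apply: eq_add; last first.
  exact: compl_form_nu (dPperp_x tX) (dPperp_x tY) tX tY.
apply: eq_bigr => k _.
exact: imag_form_nu (dPperp_T01 tX (vZ k)) (dPperp_T01 tY (vZ k))
  (tN _ k tX) (tN _ k tY).
Qed.

End PullbackFormula.

Theorem proposition5p7 (R : realType) (n : nat) (hn : n = 1%N \/ n = 3%N)
    (nabla : 'cV[R]_(2 * n).+1 -> 'cV[R]_(2 * n).+1 ->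
             ('cV[R]_(2 * n).+1 -> 'cV[R]_(2 * n).+1) -> 'cV[R]_(2 * n).+1)
    (hnabla : levi_civita nabla)
    (J : 'cV[R]_(2 * n).+1 -> 'M[R]_((2 * n).+1)) (hJ : almost_complex J)
    (x X Y : 'cV[R]_(2 * n).+1)
    (hx : sphere x) (hX : tangent x X) (hY : tangent x Y)
    (m : nat) (Z : 'I_m -> 'cV[R]_(2 * n).+1)
    (hZ : forall k, tangent x (Z k))
    (hbasis : orthonormal_basis (T01 J x)
       (fun k => cplx_mx (Z k) + 'i%C *: cplx_mx (J x *m Z k)))
    (Zext : 'I_m -> 'cV[R]_(2 * n).+1 -> 'cV[R]_(2 * n).+1)
    (hZext : forall k, vector_field (Zext k) /\ Zext k x = Z k) :
  pullback_kaehler (Pperp J) x X Y =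
    (\sum_k nu J x (nablaJ nabla J x X (Zext k)) (nablaJ nabla J x Y (Zext k))
     + nu J x X Y)%:C.
Proof.
have vZ k : vector_field (Zext k) by have [] := hZext k.
have ZE : (fun k => cplx_mx (Z k) + 'i%C *: cplx_mx (J x *m Z k))
  = (fun k => cplx_mx (Zext k x) + 'i%C *: cplx_mx (J x *m Zext k x)).
  by apply/funext => k; have [_ ->] := hZext k.
move: hbasis; rewrite ZE => hb.
exact: (pullback_kaehler_Pperp hJ hx hnabla hX hY vZ hb).
Qed.
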